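(* A graph $H$ is weakly norming if and only if all its non-singleton connected components are isomorphic to each other and weakly norming. The same statement holds with ''weakly norming'' replaced by ''seminorming'', and also with ''weakly norming'' replaced by ''norming''.
   Context: Graphs are finite and simple (with at least one edge where densities are normalised). Let $\Omega$ be a standard Borel space with an atomless probability measure $\nu$. For a graph $H$ on vertex set $\{v_1,\dots,v_n\}$ and a symmetric measurable $W:\Omega^2\to\mathbb{R}$, set $t(H,W):=\int_{\Omega^n}\prod_{\{v_i,v_j\}\in E(H)}W(x_i,x_j)\,d\nu^{\otimes n}(x_1,\dots,x_n)$. Let $\mathcal{W}_H$ (resp. $\mathcal{W}_{r(H)}$) be the set of symmetric measurable $W:\Omega^2\to\mathbb{R}$ for which $|t(H,W)|$ (resp. $t(H,|W|)$) is defined and finite. $H$ is seminorming (resp. norming) if $\|W\|_H:=|t(H,W)|^{1/e(H)}$ is a seminorm (resp. norm) on $\mathcal{W}_H$, and weakly norming if $\|W\|_{r(H)}:=t(H,|W|)^{1/e(H)}$ is a norm on $\mathcal{W}_{r(H)}$. *)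

(* Defs.v *)
From HB Require Import structures.
From mathcomp Require Import all_boot all_order all_algebra.
From mathcomp Require Import all_classical all_reals all_analysis.

Set Implicit Arguments.
Unset Strict Implicit.
Unset Printing Implicit Defensive.

Import Order.TTheory GRing.Theory Num.Theory.
Import numFieldNormedType.Exports.

Local Open Scope classical_set_scope.
Local Open Scope ring_scope.

Record sgraph := SGraph {
  vertex :> finType;
  adj : rel vertex;
  adj_sym : symmetric adj;
  adj_irr : irreflexive adj }.

(* Each edge {u, v} is listed once, as the pair (u, v) whose first endpoint
   comes first in the enumeration of the vertices. *)
Definition edges (H : sgraph) : {set H * H} :=
  [set p : H * H | adj p.1 p.2 && (enum_rank p.1 < enum_rank p.2)%N]%SET.

Definition edge_num (H : sgraph) : nat := #|edges H|.

Section induced_subgraph.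
Variables (H : sgraph) (C : {set H}).

Let ind_adj : rel {x : H | x \in C} := fun x y => adj (val x) (val y).

Let ind_adj_sym : symmetric ind_adj.
Proof. by move=> x y; rewrite /ind_adj adj_sym. Qed.

Let ind_adj_irr : irreflexive ind_adj.
Proof. by move=> x; rewrite /ind_adj adj_irr. Qed.

Definition induced : sgraph := SGraph ind_adj_sym ind_adj_irr.

End induced_subgraph.

Definition graph_iso (G H : sgraph) : Prop :=
  exists2 f : G -> H, bijective f & forall x y, adj (f x) (f y) = adj x y.

Definition components (H : sgraph) : {set {set H}} :=
  equivalence_partition (connect (@adj H)) [set: H]%SET.

Definition nonsingleton_components (H : sgraph) : {set {set H}} :=
  [set C in components H | (1 < #|C|)%N]%SET.

Definition components_iso_and (P : sgraph -> Prop) (H : sgraph) : Prop :=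
  (forall C D, C \in nonsingleton_components H ->
     D \in nonsingleton_components H -> graph_iso (induced C) (induced D)) /\
  (forall C, C \in nonsingleton_components H -> P (induced C)).

(* The sigma-algebra of T is the Borel sigma-algebra of a Polish topology,
   transported to T along the bijection f. *)
Definition standard_borel (R : realType) (d : measure_display)
    (T : measurableType d) : Prop :=
  exists (M : completePseudoMetricType R) (f : T -> M),
    [/\ hausdorff_space M,
        exists2 D : set M, countable D & dense D,
        bijective f &
        (measurable : set (set T)) = [set f @^-1` B | B in <<s @open M >>]].

Definition atomless (R : realType) (d : measure_display) (T : measurableType d)
    (nu : set T -> \bar R) : Prop :=
  forall A, measurable A -> (0 < nu A)%E ->
    exists B, [/\ measurable B, B `<=` A, (0 < nu B)%E & (nu B < nu A)%E].

Section product_power.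
Context (d : measure_display) (T : measurableType d) (R : realType).

Definition tcons (n : nat) (p : T * n.-tuple T) : n.+1.-tuple T :=
  [tuple of p.1 :: p.2].

Lemma measurable_tcons (n : nat) : measurable_fun setT (@tcons n).
Proof. exact: measurable_cons. Qed.

HB.instance Definition _ (n : nat) :=
  isMeasurableFun.Build _ _ _ _ (@tcons n) (@measurable_tcons n).

(* The product measure nu^{(x) n} on T^n. *)
Fixpoint prob_power (nu : probability T R) (n : nat) :
    probability (n.-tuple T) R :=
  match n with
  | 0 => \d_([tuple] : 0.-tuple T)
  | m.+1 => distribution (nu \x prob_power nu m)%E (@tcons m)
  end.

Lemma prob_power_box (nu : probability T R) (n : nat) (A : 'I_n -> set T) :
  (forall i, measurable (A i)) ->
  prob_power nu n [set x | forall i, A i (tnth x i)] =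
  (\prod_(i < n) nu (A i))%E.
Proof.
elim: n A => [|n IHn] A mA /=.
  rewrite big_ord0 diracE mem_set//; by case.
rewrite big_ord_recl -IHn//.
set B := [set x : n.-tuple T | forall i, A (lift ord0 i) (tnth x i)].
have mB : measurable B.
  rewrite (_ : B = \bigcap_(i in [set: 'I_n])
      ((fun x => tnth x i) @^-1` A (lift ord0 i))).
    apply: fin_bigcap_measurable => //= i _.
    by rewrite -[X in measurable X]setTI; exact: measurable_tnth.
  by apply/seteqP; split=> x /= Bx i; [move=> _|]; exact: Bx.
rewrite -(product_measure1E _ _ (mA ord0) mB) /distribution /pushforward.
congr (product_measure1 _ _ _).
apply/seteqP; split=> -[a x] /=.
  move=> H; split; first exact: H ord0.
  by move=> i; have := H (lift ord0 i); rewrite tnthS.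
move=> [/= Aa Bx] i; case: (unliftP ord0 i) => [j|] -> //.
by rewrite tnthS; exact: Bx.
Qed.

End product_power.

Section graph_densities.
Context (R : realType) (d : measure_display) (T : measurableType d).
Variable nu : probability T R.
Implicit Types (H : sgraph) (W : T * T -> R).

(* The vertices of H index the coordinates of x through their rank. *)
Definition edge_prod H W (x : #|H|.-tuple T) : R :=
  \prod_(p in edges H) W (tnth x (enum_rank p.1), tnth x (enum_rank p.2)).

Definition density H W : R :=
  \int[prob_power nu #|H|]_x edge_prod W x.

(* The integral defining t(H, W) exists and is finite. *)
Definition density_finite H W : Prop :=
  (prob_power nu #|H|).-integrable setT (EFin \o @edge_prod H W).

Definition abs_fun W : T * T -> R := fun z => `|W z|.

Definition sym_measurable W : Prop :=
  measurable_fun setT W /\ forall x y, W (x, y) = W (y, x).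

Definition kernels H : set (T * T -> R) :=
  [set W | sym_measurable W /\ density_finite H W].

Definition abs_kernels H : set (T * T -> R) :=
  [set W | sym_measurable W /\ density_finite H (abs_fun W)].

Definition norm_H H W : R := `|density H W| `^ (edge_num H)%:R^-1.

Definition norm_rH H W : R := density H (abs_fun W) `^ (edge_num H)%:R^-1.

(* S is a linear space of functions and N is a seminorm on it. *)
Definition is_seminorm (S : set (T * T -> R)) (N : (T * T -> R) -> R) : Prop :=
  [/\ S (cst 0) /\
      (forall (a : R) U W, S U -> S W -> S ((a \*o U) \+ W)),
      forall W, S W -> 0 <= N W,
      forall (a : R) W, S W -> N (a \*o W) = `|a| * N W &
      forall U W, S U -> S W -> N (U \+ W) <= N U + N W].

(* As usual for spaces of measurable functions, functions that agree almost
   everywhere are identified. *)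
Definition is_norm (S : set (T * T -> R)) (N : (T * T -> R) -> R) : Prop :=
  is_seminorm S N /\
  forall W, S W -> N W = 0 -> {ae (nu \x nu)%E, forall z, W z = 0}.

Definition seminorming H : Prop := is_seminorm (kernels H) (norm_H H).

Definition norming H : Prop := is_norm (kernels H) (norm_H H).

Definition weakly_norming H : Prop := is_norm (abs_kernels H) (norm_rH H).

End graph_densities.

(* Main.v *)
(* If the components of H are k copies of F, then t(H, W) = t(F, W) ^ k, hence
   H and F have the same kernels and the same functionals, and every property
   transfers.

   Conversely, let H satisfy the triangle inequality on nonnegative kernels,
   and put m = e(H).  For a component F with complement F' in H,
     c ^ e(F) t(F, W) <= t(H, 1 + c W) <= (1 + c ||W||_H) ^ m   for all c >= 0,
   so t(F, W) <= 2 ^ m ||W||_H ^ e(F), and the constant disappears on replacing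
   W by tensor powers.  The same holds for F', and t(F, W) t(F', W) = ||W||_H ^ m,
   which forces t(F, W) = ||W||_H ^ e(F).  Hence t(F1, W) ^ e(F2) =
   t(F2, W) ^ e(F1) for any two components.  Evaluating this on step kernels
   over equipartitions of the atomless space gives e(F1) = e(F2),
   v(F1) = v(F2), and equal numbers of homomorphisms into every graph; so F2
   has a surjective homomorphism onto F1, because F1 has one, and it is an
   isomorphism by counting vertices and edges. *)

From HB Require Import structures.
From mathcomp Require Import all_boot all_order all_algebra.
From mathcomp Require Import all_classical all_reals all_analysis measurable_realfun.
From mathcomp Require Import lra.
Require Import Defs.

Set Implicit Arguments.
Unset Strict Implicit.
Unset Printing Implicit Defensive.

Import Order.TTheory GRing.Theory Num.Theory.
Import numFieldNormedType.Exports.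

Local Open Scope classical_set_scope.
Local Open Scope ring_scope.

(** * Atomless probability measures *)

Section atomless_measure.
Context (d : measure_display) (T : measurableType d) (R : realType).
Variable nu : probability T R.

Let m (A : set T) : R := fine (nu A).

Let mE A : measurable A -> nu A = (m A)%:E.
Proof. by move=> mA; rewrite fineK// fin_num_measure. Qed.

Let m_ge0 A : 0 <= m A.
Proof. exact: fine_ge0. Qed.

Let mD A B : measurable A -> measurable B -> B `<=` A ->
  m (A `\` B) = m A - m B.
Proof.
move=> mA mB BA; have mAB := measurableD mA mB.
apply: EFin_inj; rewrite EFinB -(mE mA) -(mE mB) -(mE mAB) measureD//.
  by rewrite (setIidr BA).
by rewrite ltey_eq fin_num_measure.
Qed.

Let m_mono A B : measurable A -> measurable B -> A `<=` B -> m A <= m B.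
Proof.
by move=> mA mB AB; rewrite -lee_fin -!mE// le_measure// inE.
Qed.

Hypothesis nu_atomless : atomless nu.

(** A proper part of positive measure or its complement has at most half the mass; [n] halvings
    bring the mass below [e]. *)
Lemma atomless_small (A : set T) (e : R) : measurable A -> (0 < nu A)%E ->
  0 < e -> exists B, [/\ measurable B, B `<=` A, 0 < m B & m B <= e].
Proof.
move=> mA A0 e0.
have halve n : exists B, [/\ measurable B, B `<=` A, 0 < m B &
    m B <= m A / 2 ^+ n].
  elim: n => [|n [B [mB BA B0 Ble]]].
    exists A; split => //; last by rewrite expr0 divr1.
    by rewrite -lte_fin -mE.
  have nuB0 : (0 < nu B)%E by rewrite mE// lte_fin.
  have [C [mC CB C0 CltB]] := nu_atomless mB nuB0.
  have {}C0 : 0 < m C by rewrite -lte_fin -mE.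
  have {}CltB : m C < m B by rewrite -lte_fin -!mE.
  rewrite exprSr invfM mulrA.
  have [Csmall|Cbig] := leP (m C) (m B / 2).
    exists C; split => //; first exact: subset_trans BA.
    by apply: (le_trans Csmall); rewrite ler_pM2r// invr_gt0.
  exists (B `\` C); rewrite mD//; split.
  - exact: measurableD.
  - by move=> x [/BA].
  - lra.
  - by apply: (@le_trans _ _ (m B / 2)); [lra|rewrite ler_pM2r// invr_gt0].
have [n nlt] : exists n, m A / 2 ^+ n <= e.
  (* Since [2 ^ n > n], it suffices that [n] exceeds [m A / e]. *)
  exists (Num.truncn (m A / e)).+1.
  rewrite ler_pdivrMr ?exprn_gt0//.
  rewrite mulrC -ler_pdivrMr//.
  have := truncnS_gt (m A / e).
  move=> /ltW/le_trans; apply.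
  by rewrite -natrX ler_nat ltnW// ltn_expl.
by have [B [? ? ? /le_trans]] := halve n; exists B; split => //; auto.
Qed.

(* Exhaustion: each step captures at least half of the mass that can still be
   added without exceeding b; a deficit in the limit would force every step to
   gain a fixed amount. *)
Lemma atomless_intermediate (A : set T) (b : R) : measurable A -> 0 <= b ->
  (b%:E <= nu A)%E ->
  exists B, [/\ measurable B, B `<=` A & nu B = b%:E].
Proof.
move=> mA b0 bA.
pose adm (B : set T) := [/\ measurable B, B `<=` A & m B <= b].
pose X := {B | adm B}.
pose rel_step (B B' : X) := sval B `<=` sval B' /\
  forall C, adm C -> sval B `<=` C ->
    m C - m (sval B) <= 2 * (m (sval B') - m (sval B)).
have step (B : X) : {B' : X | rel_step B B'}.
  apply: cid; case: B => B [mB BA Bb].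
  pose E := [set m C - m B | C in [set C | adm C /\ B `<=` C]].
  have E0 : E 0 by exists B; [split|rewrite subrr].
  have Eub : has_ubound E.
    by exists b => _ [C [[_ _ Cb] _] <-]; have := m_ge0 B; lra.
  have Esup : has_sup E by split=> //; exists 0.
  have sup0 : 0 <= sup E by exact: ub_le_sup.
  (* If nothing can be gained, [B] itself is a valid next step; otherwise some extension gains more
     than half the supremum. *)
  have [supE0|supE0] := eqVneq (sup E) 0.
    have aB : adm B by [].
    exists (exist _ B aB); split => //= C aC BC.
    rewrite subrr mulr0 -supE0; apply: ub_le_sup => //.
    by exists C.
  have supgt0 : 0 < sup E / 2 by rewrite divr_gt0// lt_neqAle eq_sym supE0.
  have [_ [C [aC BC] <-] ltC] := sup_adherent supgt0 Esup.
  exists (exist _ C aC); split => //= C' aC' BC'.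
  have : m C' - m B <= sup E by apply: ub_le_sup => //; exists C'.
  lra.
have adm0 : adm set0.
  by split => //; rewrite /m measure0.
have [F [_ Fstep]] := dependent_choice step (exist _ _ adm0).
pose G n := sval (F n).
have aG n : adm (G n) by rewrite /G; case: (F n).
have mG n : measurable (G n) by case: (aG n).
have GS n : G n `<=` G n.+1 by case: (Fstep n).
have Gnd : {homo G : n k / (n <= k)%N >-> (n <= k)%O}.
  by apply: homo_leq => [x|y x z|n]; [exact: lexx|exact: le_trans|exact/subsetPset].
pose U := \bigcup_n G n.
have mU : measurable U by exact: bigcup_measurable.
have UA : U `<=` A by move=> x [n _]; case: (aG n) => _ + _; exact.
have Ub : m U <= b.
  rewrite -lee_fin -mE//.
  have nuU := @nondecreasing_cvg_mu _ _ _ nu _ mG mU Gnd.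
  rewrite -(cvg_lim _ nuU)//.
  apply: lime_le.
    by apply: ereal_nondecreasing_is_cvgn => i j ij; apply: le_measure;
      rewrite ?inE//; exact/subsetPset/Gnd.
  by near=> n => /=; rewrite mE// lee_fin; case: (aG n).
exists U; split => //; rewrite mE//; congr EFin; apply/eqP.
rewrite eq_le Ub /= leNgt; apply/negP => Ultb.
have AU0 : (0 < nu (A `\` U))%E.
  rewrite mE; last exact: measurableD.
  by rewrite lte_fin mD// subr_gt0 (lt_le_trans Ultb)// -lee_fin -mE.
have [|C [mC CAU C0 Cb]] := @atomless_small _ (b - m U) (measurableD mA mU) AU0.
  by rewrite subr_gt0.
have mUC : m (U `|` C) = m U + m C.
  apply: EFin_inj; rewrite EFinD -!mE//; last exact: measurableU.
  rewrite measureU//; apply/seteqP; split=> // x [Ux /CAU[]//].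
have aUC : adm (U `|` C).
  split; [exact: measurableU| |by rewrite mUC; lra].
  by move=> x [/UA//|/CAU[]].
(* The union of [U] and [C] is an admissible extension of every [G n], gaining at least [m C]. *)
have gain n : m C / 2 <= m (G n.+1) - m (G n).
  have GU : G n `<=` U by move=> x Gx; exists n.
  have [_ /(_ _ aUC (subset_trans GU (@subsetUl _ _ _)))] := Fstep n.
  rewrite -/(G n) -/(G n.+1) mUC.
  have := m_mono (mG n) mU GU; lra.
have unbounded n : n%:R * (m C / 2) <= m (G n).
  elim: n => [|n IHn]; first by rewrite mul0r.
  by have := gain n; rewrite -[n.+1%:R]natr1 mulrDl mul1r; lra.
pose n := (Num.truncn (b / (m C / 2))).+1.
have := unbounded n; case: (aG n) => _ _ Gb /le_trans/(_ Gb).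
rewrite leNgt => /negP; apply.
rewrite -ltr_pdivrMr ?divr_gt0//.
exact: truncnS_gt.
Unshelve. all: by end_near.
Qed.

(** A piece of measure [c] is cut off and labelled [k.+1]; induction labels the rest. The labelling
    is total on [T], so its classes are measured inside [A]. *)
Lemma atomless_equipartition_nat (k : nat) (c : R) (A : set T) :
  measurable A -> 0 <= c -> nu A = (c *+ k.+1)%:E ->
  exists f : T -> nat, [/\ forall i, measurable (f @^-1` [set i]),
    forall x, (f x <= k)%N &
    forall i, (i <= k)%N -> nu (A `&` f @^-1` [set i]) = c%:E].
Proof.
move=> + c0; elim: k A => [|k IHk] A mA nuA.
  exists (cst 0%N); split => // i.
    by rewrite preimage_cst; case: ifP.
  by rewrite leqn0 => /eqP ->; rewrite preimage_cst mem_set// setIT nuA.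
have [|B [mB BA nuB]] := atomless_intermediate mA c0.
  by rewrite nuA lee_fin mulrS lerDl mulrn_wge0.
have mAB := measurableD mA mB.
have [|f [mf fk fc]] := IHk _ mAB.
  have -> : nu (A `\` B) = (m A - m B)%:E by rewrite mE// mD.
  by rewrite /m nuA nuB/= mulrS addrAC subrr add0r.
have E i : (fun x => if x \in B then k.+1 else f x) @^-1` [set i] =
    if i == k.+1 then B else f @^-1` [set i] `\` B.
  apply/seteqP; split=> x /=.
    case: ifPn => [xB <-|xB <-]; first by rewrite eqxx; exact: set_mem.
    rewrite ltn_eqF ?ltnS//; split => // Bx.
    by move: xB; rewrite mem_set.
  case: eqP => [-> Bx|_ [fx nBx]]; first by rewrite mem_set.
  by rewrite memNset.
exists (fun x => if x \in B then k.+1 else f x); split => [i|x|i].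
- by rewrite E; case: ifP => // _; exact: measurableD.
- by case: ifP => // _; exact: leqW.
rewrite E leq_eqVlt => /predU1P[->|ik].
  by rewrite eqxx (setIidr BA).
by rewrite (ltn_eqF ik) -setIDAC fc.
Qed.

Lemma atomless_equipartition (K : finType) : (0 < #|K|)%N ->
  exists f : T -> K, forall a, measurable (f @^-1` [set a]) /\
    nu (f @^-1` [set a]) = (#|K|%:R^-1)%:E.
Proof.
move=> K0; case/card_gt0P: (K0) => a0 _.
have [||f [mf fk fc]] := @atomless_equipartition_nat #|K|.-1 #|K|%:R^-1 setT measurableT.
- by rewrite invr_ge0.
- by rewrite probability_setT prednK// -[_^-1 *+ _]mulr_natr mulVf// pnatr_eq0 -lt0n.
exists (fun x => nth a0 (enum K) (f x)) => a.
have -> : (fun x => nth a0 (enum K) (f x)) @^-1` [set a] =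
    f @^-1` [set nat_of_ord (enum_rank a)].
  apply/seteqP; split=> x /=.
    have fx : (f x < #|K|)%N by rewrite (leq_ltn_trans (fk x))// prednK.
    by move=> <-; rewrite -(enum_val_nth a0 (Ordinal fx)) enum_valK.
  by move=> ->; rewrite -enum_val_nth enum_rankK.
split => //; rewrite -[X in nu X]setTI fc//.
by rewrite -ltnS prednK.
Qed.

End atomless_measure.

(** * Product powers of a probability measure *)

Section product_power_theory.
Context (d : measure_display) (T : measurableType d) (R : realType).
Variable nu : probability T R.

Let box n (A : 'I_n -> set T) : set (n.-tuple T) :=
  [set x | forall i, A i (tnth x i)].

Let measurable_box n (A : 'I_n -> set T) :
  (forall i, measurable (A i)) -> measurable (box A).
Proof.
move=> mA.
rewrite (_ : box A = \bigcap_(i in [set: 'I_n]) ((fun x => tnth x i) @^-1` A i)).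
  apply: fin_bigcap_measurable => //= i _.
  by rewrite -[X in measurable X]setTI; exact: measurable_tnth.
by apply/seteqP; split=> x /= Ax i; [move=> _|]; exact: Ax.
Qed.

(** Boxes form an intersection-stable generating family, and the whole space is a box of finite
    measure, so the values on boxes determine the measure. *)
Lemma prob_power_unique n (mu : {measure set (n.-tuple T) -> \bar R}) :
  (forall A : 'I_n -> set T, (forall i, measurable (A i)) ->
    mu [set x | forall i, A i (tnth x i)] = (\prod_(i < n) nu (A i))%E) ->
  forall X, measurable X -> mu X = prob_power nu n X.
Proof.
move=> muE X mX.
pose G : set (set (n.-tuple T)) :=
  [set B | exists2 A, (forall i, measurable (A i)) & B = box A].
have boxT : [set: n.-tuple T] = box (fun _ => setT).
  by apply/seteqP; split.
have GT : G setT by exists (fun _ => setT) => //; exact: boxT.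
have sG : G `<=` measurable by move=> _ [A mA ->]; exact: measurable_box.
apply: (measure_unique G (fun _ => setT)) => //.
- apply/seteqP; split; last first.
    by apply: smallest_sub => //; exact: sigma_algebra_measurable.
  apply: smallest_sub; first exact: smallest_sigma_algebra.
  move=> B; rewrite -bigcup_seq => -[i /= _ [C mC <-]].
  (* The sigma-algebra of tuples is generated by one-coordinate cylinders; a cylinder is the box
     whose other sides are the whole space. *)
  apply: sub_sigma_algebra; exists (fun j => if j == i then C else setT).
    by move=> j; case: ifP.
  rewrite setTI; apply/seteqP; split=> x /= Cx.
    by move=> j; case: eqP => [->|].
  by have := Cx i; rewrite eqxx.
- move=> _ _ [A mA ->] [B mB ->]; exists (fun i => A i `&` B i).
    by move=> i; exact: measurableI.
  by apply/seteqP; split=> x /= => [[Ax Bx] i|ABx]; [|split=> i; have [] := ABx i].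
- by rewrite bigcup_const.
- by move=> _ [A mA ->]; exact: etrans (muE _ mA) (esym (prob_power_box nu mA)).
- by move=> _; rewrite boxT muE// big1 ?ltry// => i _; rewrite probability_setT.
Qed.

Definition sel m n (s : 'I_m -> 'I_n) (x : n.-tuple T) : m.-tuple T :=
  [tuple tnth x (s i) | i < m].

Lemma tnth_sel m n (s : 'I_m -> 'I_n) x i : tnth (sel s x) i = tnth x (s i).
Proof. exact: tnth_mktuple. Qed.

Lemma measurable_sel m n (s : 'I_m -> 'I_n) : measurable_fun setT (sel s).
Proof.
apply/measurable_fun_tnthP => i.
rewrite (_ : _ \o _ = fun x => tnth x (s i)); first exact: measurable_tnth.
by apply/funext => x /=; rewrite tnth_sel.
Qed.

HB.instance Definition _ m n (s : 'I_m -> 'I_n) :=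
  isMeasurableFun.Build _ _ _ _ (sel s) (measurable_sel s).

(** The preimage of a box is a box. Its sides outside the image of [s] are the whole space and
    contribute the factor 1; by injectivity each other side is constrained once. *)
Lemma distribution_sel m n (s : 'I_m -> 'I_n) : injective s ->
  forall X, measurable X ->
    distribution (prob_power nu n) (sel s) X = prob_power nu m X.
Proof.
move=> inj_s; apply: prob_power_unique => A mA.
pose B j := if [pick i | s i == j] is Some i then A i else setT.
have Bs i : B (s i) = A i.
  by rewrite /B; case: pickP => [k /eqP/inj_s ->|/(_ i)]; rewrite ?eqxx.
have mB j : measurable (B j) by rewrite /B; case: pickP.
rewrite /= /distribution /pushforward.
rewrite (_ : _ @^-1` _ = box B); last first.
  apply/seteqP; split=> x /= Ax.
    move=> j; rewrite /B; case: pickP => // i /eqP <-.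
    by have := Ax i; rewrite tnth_sel.
  by move=> i; rewrite tnth_sel -Bs; exact: Ax.
rewrite prob_power_box// (bigID [in s @: [set: 'I_m]%SET]) /=.
rewrite [X in (_ * X)%E]big1 ?mule1 => [|j sj]; last first.
  rewrite /B; case: pickP => [i /eqP ij|]; last by rewrite probability_setT.
  by rewrite -ij imset_f ?inE in sj.
rewrite big_imset/=; last by move=> i j _ _ /inj_s.
by apply: eq_big => [i|i _]; rewrite ?inE// Bs.
Qed.

Definition catp m p (z : m.-tuple T * p.-tuple T) : (m + p).-tuple T :=
  [tuple of z.1 ++ z.2].

Lemma measurable_catp m p : measurable_fun setT (@catp m p).
Proof.
apply/measurable_fun_tnthP => i; case: (split_ordP i) => j ->.
  rewrite (_ : _ \o _ = (fun x => tnth x j) \o fst).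
    by apply: measurableT_comp; [exact: measurable_tnth|exact: measurable_fst].
  by apply/funext => -[x y] /=; rewrite tnth_lshift.
rewrite (_ : _ \o _ = (fun x => tnth x j) \o snd).
  by apply: measurableT_comp; [exact: measurable_tnth|exact: measurable_snd].
by apply/funext => -[x y] /=; rewrite tnth_rshift.
Qed.

HB.instance Definition _ m p :=
  isMeasurableFun.Build _ _ _ _ (@catp m p) (@measurable_catp m p).

Lemma distribution_catp m p : forall X, measurable X ->
  distribution (prob_power nu m \x prob_power nu p)%E (@catp m p) X =
  prob_power nu (m + p) X.
Proof.
apply: prob_power_unique => A mA.
have mAl i : measurable (A (lshift p i)) by [].
have mAr i : measurable (A (rshift m i)) by [].
rewrite big_split_ord/= -(prob_power_box nu mAl) -(prob_power_box nu mAr).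
rewrite -(product_measure1E _ _ (measurable_box mAl) (measurable_box mAr)).
rewrite /= /distribution /pushforward; congr (product_measure1 _ _ _).
apply/seteqP; split=> -[a b] /=.
  move=> Aab; split=> i.
    by have := Aab (lshift p i); rewrite tnth_lshift.
  by have := Aab (rshift m i); rewrite tnth_rshift.
by move=> [Aa Ab] i; case: (split_ordP i) => j ->; rewrite ?tnth_lshift ?tnth_rshift.
Qed.

Section pair.
Variables (m p n : nat) (s : 'I_m -> 'I_n) (t : 'I_p -> 'I_n).

Definition sel2 (x : n.-tuple T) := (sel s x, sel t x).

Lemma measurable_sel2 : measurable_fun setT sel2.
Proof. by apply: measurable_fun_pair; exact: measurable_sel. Qed.

HB.instance Definition _ := isMeasurableFun.Build _ _ _ _ sel2 measurable_sel2.

(** Disjoint sets of coordinates are independent: [s] and [t] glue to one injection of ['I_(m + p)],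
    whose marginal is a power of [nu], and concatenation identifies that power with the product. *)
Lemma distribution_sel2 : injective s -> injective t ->
  (forall i j, s i != t j) -> forall X, measurable X ->
  distribution (prob_power nu n) sel2 X =
  (prob_power nu m \x prob_power nu p)%E X.
Proof.
move=> inj_s inj_t st X mX.
pose u (i : 'I_(m + p)) := match fintype.split i with inl a => s a | inr b => t b end.
have ul a : u (lshift p a) = s a.
  by rewrite /u (unsplitK (inl a)).
have ur b : u (rshift m b) = t b.
  by rewrite /u (unsplitK (inr b)).
have inj_u : injective u.
  move=> i j; case: (split_ordP i) => a ->; case: (split_ordP j) => b ->;
    rewrite ?ul ?ur.
  - by move=> /inj_s ->.
  - by move=> /eqP; rewrite (negbTE (st _ _)).
  - by move=> /esym/eqP; rewrite (negbTE (st _ _)).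
  - by move=> /inj_t ->.
pose C := [set y : (m + p).-tuple T | X (sel (@lshift m p) y, sel (@rshift m p) y)].
have mC : measurable C.
  have mlr : measurable_fun setT (fun y : (m + p).-tuple T =>
      (sel (@lshift m p) y, sel (@rshift m p) y)).
    by apply: measurable_fun_pair; exact: measurable_sel.
  by rewrite -[C]setTI; exact: mlr.
have := distribution_sel inj_u mC; rewrite -distribution_catp//.
rewrite /= /distribution /pushforward.
have -> : sel u @^-1` C = sel2 @^-1` X.
  rewrite /C /sel2 /preimage; apply/seteqP; split=> x /=; congr (X (_, _));
    by apply: eq_from_tnth => i; rewrite !tnth_sel ?ul ?ur.
have -> // : @catp m p @^-1` C = X.
rewrite /C /preimage; apply/seteqP; split=> -[x y] /=; congr (X (_, _));
  by apply: eq_from_tnth => i; rewrite tnth_sel ?tnth_lshift ?tnth_rshift.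
Qed.

End pair.
End product_power_theory.

(** * Densities of disjoint unions *)

Section embedding.

Definition embedding (G H : sgraph) (f : G -> H) :=
  injective f /\ forall x y, adj (f x) (f y) = adj x y.

Lemma embedding_val (H : sgraph) (C : {set H}) :
  @embedding (induced C) H (fun x => val x).
Proof. by split=> //; exact: val_inj. Qed.

Context (R : Type) (idx : R) (op : Monoid.com_law idx).

(* The edge images are re-oriented, since f need not respect the enumerations
   of the vertices that orient the edges of G and H. *)
Lemma big_edges_embedding (G H : sgraph) (f : G -> H) (F : H -> H -> R) :
  embedding f -> (forall x y, F x y = F y x) ->
  \big[op/idx]_(p in edges H | (p.1 \in codom f) && (p.2 \in codom f))
    F p.1 p.2 =
  \big[op/idx]_(p in edges G) F (f p.1) (f p.2).
Proof.
move=> [inj_f fadj] Fsym.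
pose orient (p : H * H) :=
  if (enum_rank p.1 < enum_rank p.2)%N then p else (p.2, p.1).
pose emb (p : G * G) := orient (f p.1, f p.2).
have Femb p : F (emb p).1 (emb p).2 = F (f p.1) (f p.2).
  by rewrite /emb /orient; case: ifP.
have inj_emb : {in edges G &, injective emb}.
  move=> [a b] [a' b']; rewrite !inE/= /emb /orient/= => /andP[_ ab] /andP[_ ab'].
  case: ifP => _; case: ifP => _ [] /inj_f ? /inj_f ?; subst => //.
    by move: ab; rewrite ltnNge ltnW.
  by move: ab; rewrite ltnNge ltnW.
rewrite -(eq_bigr _ (fun p _ => Femb p)).
rewrite -(big_imset (fun p => F p.1 p.2) inj_emb).
apply: eq_bigl => -[x y] /=; apply/idP/imsetP => /=.
  rewrite inE/= => /andP[/andP[xy ltxy] /andP[/codomP[a xa] /codomP[b yb]]].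
  subst x y; rewrite fadj in xy.
  have [ltab|leba] := ltnP (enum_rank a) (enum_rank b).
    by exists (a, b); rewrite ?inE/= ?xy// /emb /orient/= ltxy.
  exists (b, a); last by rewrite /emb /orient/= ltnNge (ltnW ltxy).
  rewrite inE/= adj_sym xy /= ltn_neqAle leba andbT.
  apply/negP => /eqP/val_inj/enum_rank_inj ba.
  by rewrite ba adj_irr in xy.
move=> [[a b]]; rewrite !inE/= => /andP[ab ltab] xyE.
have {xyE}: (x, y) = (f a, f b) /\ (enum_rank (f a) < enum_rank (f b))%N \/
    (x, y) = (f b, f a) /\ (enum_rank (f b) <= enum_rank (f a))%N.
  by move: xyE; rewrite /emb /orient/=; case: ltnP => ? ?; [left|right].
move=> [[[-> ->] lt]|[[-> ->] le]]; rewrite !codom_f fadj ?ab ?lt//.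
rewrite adj_sym ab /= andbT ltn_neqAle le andbT.
apply/negP => /eqP/val_inj/enum_rank_inj/inj_f ba.
by rewrite ba adj_irr in ab.
Qed.

(** Vertices of [H] outside both images are allowed; they are isolated. *)
Definition disjoint_cover (G1 G2 H : sgraph) (f1 : G1 -> H) (f2 : G2 -> H) :=
  (forall x y, f1 x != f2 y) /\
  forall x y, adj x y -> (x \in codom f1) && (y \in codom f1) ||
                         (x \in codom f2) && (y \in codom f2).

(** Stated for any commutative monoid, so that one splitting both counts edges and factors edge
    products. *)
Lemma big_edges_split (G1 G2 H : sgraph) (f1 : G1 -> H) (f2 : G2 -> H)
    (F : H -> H -> R) :
  embedding f1 -> embedding f2 -> disjoint_cover f1 f2 ->
  (forall x y, F x y = F y x) ->
  \big[op/idx]_(p in edges H) F p.1 p.2 =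
  op (\big[op/idx]_(p in edges G1) F (f1 p.1) (f1 p.2))
     (\big[op/idx]_(p in edges G2) F (f2 p.1) (f2 p.2)).
Proof.
move=> emb1 emb2 [f12 cov] Fsym.
rewrite (bigID (fun p => (p.1 \in codom f1) && (p.2 \in codom f1))) /=.
rewrite (big_edges_embedding emb1 Fsym); congr (op _ _).
rewrite -(big_edges_embedding emb2 Fsym); apply: eq_bigl => -[x y] /=.
rewrite inE/=; case xy : (adj x y) => //=; case: ltnP => //= _.
have dis z : z \in codom f1 -> z \in codom f2 -> false.
  by move=> /codomP[a ->] /codomP[b] /eqP; rewrite (negbTE (f12 _ _)).
have := cov _ _ xy; case: (boolP (x \in codom f1)) => x1 /=; last by move->.
have /negbTE -> : x \notin codom f2 by apply/negP => /(dis _ x1).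
by rewrite orbF => ->.
Qed.

End embedding.

Section product_integral.
Context (d1 d2 : measure_display) (T1 : measurableType d1)
  (T2 : measurableType d2) (R : realType).
Variables (mu1 : probability T1 R) (mu2 : probability T2 R).
Local Open Scope ereal_scope.

Lemma ge0_integral_prod (f : T1 -> \bar R) (g : T2 -> \bar R) :
  measurable_fun setT f -> measurable_fun setT g ->
  (forall x, 0 <= f x) -> (forall y, 0 <= g y) ->
  \int[mu1 \x mu2]_z (f z.1 * g z.2) = \int[mu1]_x f x * \int[mu2]_y g y.
Proof.
move=> mf mg f0 g0.
rewrite fubini_tonelli1/=; first last.
- by move=> z; exact: mule_ge0.
- apply: emeasurable_funM.
    exact: (measurableT_comp mf measurable_fst).
  exact: (measurableT_comp mg measurable_snd).
rewrite /fubini_F/=.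
under eq_integral do rewrite ge0_integralZl//.
by rewrite ge0_integralZr// integral_ge0.
Qed.

Lemma Rintegral_prod (f : T1 -> R) (g : T2 -> R) :
  mu1.-integrable setT (EFin \o f) -> mu2.-integrable setT (EFin \o g) ->
  (mu1 \x mu2).-integrable setT (EFin \o (fun z => f z.1 * g z.2)%R) ->
  (\int[mu1 \x mu2]_z (f z.1 * g z.2) =
   (\int[mu1]_x f x) * \int[mu2]_y g y)%R.
Proof.
move=> intf intg intfg.
have fing := integrable_fin_num measurableT intg.
have finf := integrable_fin_num measurableT intf.
rewrite /Rintegral -(integral12_prod_meas1 intfg) /fubini_F/=.
under eq_integral do
  (under eq_integral do rewrite EFinM; rewrite integralZl//).
rewrite -(fineK fing) integralZr//=.
by rewrite -(fineK finf) -EFinM.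
Qed.

End product_integral.

Section density_theory.
Context (R : realType) (d : measure_display) (T : measurableType d).
Variable nu : probability T R.
Implicit Types (G H : sgraph) (W : T * T -> R).

(** Kept in the extended reals, where it factorises without integrability assumptions and finiteness
    means being below [+oo]. *)
Definition abs_density H W : \bar R :=
  (\int[prob_power nu #|H|]_x `|(edge_prod W x)%:E|)%E.

Lemma measurable_edge_prod H W : measurable_fun setT W ->
  measurable_fun setT (@edge_prod R d T H W).
Proof.
move=> mW.
rewrite (_ : @edge_prod _ _ _ _ _ = fun x => \prod_(p <- enum (edges H))
    W (tnth x (enum_rank p.1), tnth x (enum_rank p.2))); last first.
  by apply/funext => x; rewrite big_enum.
apply: measurable_prod => p _.
apply: (@measurableT_comp _ _ _ _ _ _ W) => //.
by apply: measurable_fun_pair; exact: measurable_tnth.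
Qed.

Lemma density_finiteE H W : measurable_fun setT W ->
  density_finite nu H W <-> (abs_density H W < +oo)%E.
Proof.
move=> mW; split=> [/integrableP[]//|lt]; apply/integrableP; split=> //.
by apply/measurable_EFinP; exact: measurable_edge_prod.
Qed.

Definition rank_map G H (f : G -> H) (i : 'I_#|G|) : 'I_#|H| :=
  enum_rank (f (enum_val i)).

Lemma edge_prod_rank_map G H (f : G -> H) W (x : #|H|.-tuple T) :
  edge_prod W (sel (rank_map f) x) =
  \prod_(p in edges G)
    W (tnth x (enum_rank (f p.1)), tnth x (enum_rank (f p.2))).
Proof. by apply: eq_bigr => p _; rewrite !tnth_sel /rank_map !enum_rankK. Qed.

Lemma rank_map_inj G H (f : G -> H) : injective f -> injective (rank_map f).
Proof. by move=> inj_f i j /enum_rank_inj/inj_f/enum_val_inj. Qed.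

Section split.
Context (G1 G2 H : sgraph) (f1 : G1 -> H) (f2 : G2 -> H).
Hypotheses (emb1 : embedding f1) (emb2 : embedding f2).
Hypothesis cover : disjoint_cover f1 f2.

Lemma edge_num_split : edge_num H = (edge_num G1 + edge_num G2)%N.
Proof.
rewrite /edge_num -!sum1_card.
exact: (@big_edges_split nat 0%N addn _ _ _ _ _ (fun _ _ => 1%N) emb1 emb2 cover).
Qed.

Let r1 := rank_map_inj (proj1 emb1).
Let r2 := rank_map_inj (proj1 emb2).
Let r12 i j : rank_map f1 i != rank_map f2 j.
Proof. by apply/eqP => /enum_rank_inj/eqP; rewrite (negbTE (cover.1 _ _)). Qed.

Let phi : #|H|.-tuple T -> _ := sel2 (rank_map f1) (rank_map f2).

Variable W : T * T -> R.
Hypothesis Wsm : sym_measurable W.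

Let mP G : measurable_fun setT (@edge_prod R d T G W) :=
  measurable_edge_prod Wsm.1.

Let mabs G : measurable_fun setT
  (fun x : #|G|.-tuple T => `|(edge_prod W x)%:E|%E).
Proof. by apply: measurableT_comp => //; apply/measurable_EFinP; exact: mP. Qed.

Let edge_prodE : @edge_prod R d T H W =
  (fun z => edge_prod W z.1 * edge_prod W z.2) \o phi.
Proof.
apply/funext => x; rewrite /= !edge_prod_rank_map.
apply: (@big_edges_split R 1 *%R _ _ _ _ _ (fun u v =>
  W (tnth x (enum_rank u), tnth x (enum_rank v))) emb1 emb2 cover) => u v.
exact: Wsm.2.
Qed.

(** The two factors of the edge product read disjoint sets of coordinates, so their joint law is a
    product measure and Tonelli applies. Vertices outside both images integrate out. *)
Lemma abs_density_split :
  abs_density H W = (abs_density G1 W * abs_density G2 W)%E.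
Proof.
rewrite /abs_density -(ge0_integral_prod _ _ (@mabs G1) (@mabs G2))//.
rewrite edge_prodE.
pose h (z : #|G1|.-tuple T * #|G2|.-tuple T) : \bar R :=
  (`|(edge_prod W z.1)%:E| * `|(edge_prod W z.2)%:E|)%E.
transitivity (\int[prob_power nu #|H|]_x (h \o phi) x)%E.
  by apply: eq_integral => x _; rewrite /h/= normrM EFinM.
rewrite -(@ge0_integral_distribution _ _ _ _ _ (prob_power nu #|H|) phi).
- by apply: eq_measure_integral => A mA _; exact: distribution_sel2.
- apply: emeasurable_funM; apply: measurableT_comp => //; apply/measurable_EFinP.
    exact: (measurableT_comp (@mP G1) measurable_fst).
  exact: (measurableT_comp (@mP G2) measurable_snd).
- by move=> z; rewrite mule_ge0.
Qed.

(** Finiteness for [H] alone does not give finiteness for the pieces, because [0 * +oo = 0].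
    Integrability on the product space comes from [abs_density_split]. *)
Lemma density_split : density_finite nu H W ->
  density_finite nu G1 W -> density_finite nu G2 W ->
  density nu H W = density nu G1 W * density nu G2 W.
Proof.
move=> finH fin1 fin2.
pose h (z : #|G1|.-tuple T * #|G2|.-tuple T) :=
  edge_prod W z.1 * edge_prod W z.2.
have mh : measurable_fun setT (EFin \o h).
  apply/measurable_EFinP; apply: measurable_funM.
    exact: (measurableT_comp (@mP G1) measurable_fst).
  exact: (measurableT_comp (@mP G2) measurable_snd).
rewrite -Rintegral_prod//.
  rewrite /density edge_prodE /Rintegral; congr fine.
  rewrite -(@integral_distribution _ _ _ _ _ (prob_power nu #|H|) phi (EFin \o h))//.
    by apply: eq_measure_integral => A mA _; exact: distribution_sel2.
  by move: finH; rewrite /density_finite edge_prodE.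
apply/integrableP; split => //.
rewrite [ltLHS](_ : _ = abs_density G1 W * abs_density G2 W)%E.
  by rewrite -abs_density_split; apply/density_finiteE => //; case: Wsm.
rewrite /abs_density -(ge0_integral_prod _ _ (@mabs G1) (@mabs G2))//.
by apply: eq_integral => z _; rewrite /h/= normrM EFinM.
Qed.

End split.
End density_theory.

(** * Connected components *)

Section components_theory.
Variable H : sgraph.
Implicit Types (C D : {set H}).

Let csym : connect_sym (@adj H) := sym_connect_sym (@adj_sym H).

Lemma componentP C x : C \in components H -> x \in C ->
  C = [set y | connect (@adj H) x y]%SET.
Proof.
move=> /imsetP[z _ ->]; rewrite !inE/= => zx; apply/setP => y; rewrite !inE/=.
exact: same_connect csym _ _ zx _.
Qed.

Lemma component_connect C x y : C \in components H -> x \in C -> y \in C ->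
  connect (@adj H) x y.
Proof. by move=> compC xC; rewrite (componentP compC xC) inE. Qed.

Lemma component_closed C x y : C \in components H -> adj x y ->
  (x \in C) = (y \in C).
Proof.
move=> compC xy; apply/idP/idP => zC; rewrite (componentP compC zC) inE.
  exact: connect1.
by rewrite connect1// adj_sym.
Qed.

Lemma component_disjoint C D : C \in components H -> D \in components H ->
  C != D -> forall x, x \in C -> x \notin D.
Proof.
move=> compC compD CD x xC; apply: contra CD => xD.
by rewrite (componentP compC xC) -(componentP compD xD).
Qed.

Lemma edge_component x y : adj x y ->
  exists2 C, C \in nonsingleton_components H & x \in C.
Proof.
move=> xy; have compx : [set z in [set: H] | connect (@adj H) x z]%SET \in components H.
  exact: imset_f.
exists [set z in [set: H] | connect (@adj H) x z]%SET; last first.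
  by rewrite !inE/= connect0.
rewrite inE compx/=; apply/card_gt1P; exists x, y; split.
- by rewrite !inE/= connect0.
- by rewrite !inE/= connect1.
- by apply: contraTneq xy => ->; rewrite adj_irr.
Qed.

(** The neighbour is the first step of a path from [x] to another vertex of [C]. *)
Lemma component_neighbour C x : C \in nonsingleton_components H -> x \in C ->
  exists2 y, y \in C & adj x y.
Proof.
rewrite inE => /andP[compC /card_gt1P[a [b [aC bC ab]]]] xC.
have [z zC xz] : exists2 z, z \in C & x != z.
  have [xa|] := eqVneq x a; last by exists a.
  by exists b; rewrite // xa.
have xz' : connect (@adj H) x z by exact: component_connect compC xC zC.
case/connectP: xz' => [[|y p] /=].
  by move=> _ zx; rewrite zx eqxx in xz.
by move=> /andP[xy _] _; exists y; rewrite // -(component_closed compC xy).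
Qed.

(** A path between vertices of [C] stays inside [C] and carries the value along. This is
    connectedness in the form of [edge_connected]. *)
Lemma component_const (A : Type) C (g : induced C -> A) : C \in components H ->
  (forall x y, adj x y -> g x = g y) -> forall x y, g x = g y.
Proof.
move=> compC gadj x y.
have : connect (@adj H) (val x) (val y).
  exact: component_connect compC (valP x) (valP y).
case/connectP => p; elim: p x => [|z p IHp] x /=.
  by move=> _ /val_inj ->.
move=> /andP[xz pz] yz.
have zC : z \in C by rewrite -(component_closed compC xz) (valP x).
rewrite (gadj _ (exist _ z zC : induced C))//.
exact: IHp.
Qed.

End components_theory.

Definition incl (H : sgraph) (C D : {set H}) (CD : C \subset D)
    (x : induced C) : induced D :=
  exist _ (val x) (fintype.subsetP CD _ (valP x)).

Lemma embedding_incl (H : sgraph) (C D : {set H}) (CD : C \subset D) :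
  embedding (incl CD).
Proof. by split=> // x y /(congr1 val)/= /val_inj. Qed.

Lemma codom_incl (H : sgraph) (C D : {set H}) (CD : C \subset D) (x : induced D) :
  (x \in codom (incl CD)) = (val x \in C).
Proof.
apply/codomP/idP => [[y ->]|xC]; first exact: (valP y).
by exists (exist _ (val x) xC); exact: val_inj.
Qed.

Lemma disjoint_cover_incl (H : sgraph) (C D U : {set H})
    (CU : C \subset U) (DU : D \subset U) :
  (forall x, x \in C -> x \notin D) -> U \subset C :|: D ->
  (forall x y, adj x y -> (x \in C) = (y \in C)) ->
  (forall x y, adj x y -> (x \in D) = (y \in D)) ->
  disjoint_cover (incl CU) (incl DU).
Proof.
move=> dCD UCD Cadj Dadj; split=> [x y|x y xy].
  apply/eqP => /(congr1 val) xy.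
  have yx : val y = val x by rewrite -[RHS]/(val (incl CU x)) xy.
  by have := dCD _ (valP x); rewrite -yx (valP y).
rewrite !codom_incl.
have -> : (val y \in C) = (val x \in C) by rewrite (Cadj _ _ xy).
have -> : (val y \in D) = (val x \in D) by rewrite (Dadj _ _ xy).
by rewrite !andbb -finset.in_setU (fintype.subsetP UCD)// (valP x).
Qed.

Lemma disjoint_cover_setC (H : sgraph) (C : {set H}) : C \in components H ->
  @disjoint_cover (induced C) (induced (~: C)%SET) H
    (fun x => val x) (fun x => val x).
Proof.
move=> compC; split=> [x y|x y xy].
  by apply: contraTneq (valP x) => ->; have := valP y; rewrite /= inE.
have codomC (D : {set H}) z : z \in D -> z \in codom (fun x : induced D => val x).
  by move=> zD; apply/codomP; exists (exist _ z zD).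
case: (boolP (x \in C)) => xC.
  have yC : y \in C by rewrite -(component_closed compC xy).
  by apply/orP; left; apply/andP; split; exact: codomC.
have yC : y \notin C by rewrite -(component_closed compC xy).
by apply/orP; right; apply/andP; split; apply: codomC; rewrite finset.in_setC.
Qed.

(** * Isolated vertices and disjoint unions of copies *)

Section component_powers.
Context (R : realType) (d : measure_display) (T : measurableType d).
Variable nu : probability T R.
Variables (W : T * T -> R).
Hypothesis Wsm : sym_measurable W.

Section edgeless.
Variable H : sgraph.
Hypothesis H0 : forall x y : H, adj x y = false.

Let edges0 : edges H = finset.set0.
Proof. by apply/setP => -[x y]; rewrite !inE/= H0. Qed.

Lemma edge_num_edgeless : edge_num H = 0%N.
Proof. by rewrite /edge_num edges0 cards0. Qed.

Let edge_prod_edgeless : @edge_prod R d T H W = cst 1.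
Proof. by apply/funext => x; rewrite /edge_prod edges0 big_set0. Qed.

Lemma abs_density_edgeless : abs_density nu H W = 1%E.
Proof.
rewrite /abs_density edge_prod_edgeless/=.
rewrite integral_cst// [X in (_ * X)%E](_ : _ = 1%E) ?normr1 ?mule1//.
exact: probability_setT.
Qed.

Lemma density_edgeless : density nu H W = 1.
Proof.
rewrite /density edge_prod_edgeless Rintegral_cst// mul1r.
by rewrite [X in fine X](_ : _ = 1%E)//; exact: probability_setT.
Qed.

End edgeless.

Section covering.
Variables (G H : sgraph) (f : G -> H).
Hypotheses (femb : embedding f)
  (fcov : forall x y, adj x y -> (x \in codom f) && (y \in codom f)).

(** The second piece is the graph without vertices, so the splitting lemmas apply with a trivial
    factor; the vertices outside the image of [f] are isolated and drop out. *)
Let E := induced (finset.set0 : {set H}).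
Let noE (x : E) : False.
Proof. by case: x => x; rewrite inE. Qed.
Let j (x : E) : H := val x.
Let jemb : embedding j.
Proof. exact: embedding_val. Qed.
Let fj : disjoint_cover f j.
Proof.
by split=> [x y|x y xy]; [case: (noE y)|rewrite fcov].
Qed.
Let adjE (x y : E) : adj x y = false.
Proof. by case: (noE x). Qed.

Lemma edge_num_cover : edge_num H = edge_num G.
Proof. by rewrite (edge_num_split femb jemb fj) (edge_num_edgeless adjE) addn0. Qed.

Lemma abs_density_cover : abs_density nu H W = abs_density nu G W.
Proof.
by rewrite (abs_density_split nu femb jemb fj Wsm) (abs_density_edgeless adjE) mule1.
Qed.

Lemma density_cover : density_finite nu G W -> density nu H W = density nu G W.
Proof.
move=> finG.
rewrite (density_split femb jemb fj Wsm) ?(density_edgeless adjE) ?mulr1//.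
  by apply/(density_finiteE _ _ Wsm.1); rewrite abs_density_cover; exact/(density_finiteE _ _ Wsm.1).
by apply/(density_finiteE _ _ Wsm.1); rewrite (abs_density_edgeless adjE) ltry.
Qed.

End covering.

Section copies.
Variables (H F : sgraph).

Lemma graph_iso_cover (G : sgraph) : graph_iso G F -> exists2 f : G -> F,
  embedding f & forall x y, adj x y -> (x \in codom f) && (y \in codom f).
Proof.
move=> [f [g fK gK] fadj]; exists f; first by split=> //; exact: can_inj fK.
by move=> x y _; rewrite -[x]gK -[y]gK !codom_f.
Qed.

Let U (s : seq {set H}) := (\bigcup_(C <- s) C)%SET.

(** The head component and the union of the others form a disjoint cover, so each component in the
    list contributes one factor of [F]. *)
Lemma copies_power (s : seq {set H}) : uniq s ->
  (forall C, C \in s -> C \in components H) ->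
  (forall C, C \in s -> graph_iso (induced C) F) ->
  [/\ edge_num (induced (U s)) = (size s * edge_num F)%N,
      abs_density nu (induced (U s)) W = (abs_density nu F W ^+ size s)%E &
      density_finite nu F W ->
      density nu (induced (U s)) W = density nu F W ^+ size s].
Proof.
elim: s => [_ _ _|C s IHs /= /andP[Cs us] comps isos].
  have U0 (x y : induced (U [::])) : adj x y = false.
    have Unil : U [::] = finset.set0 by rewrite /U big_nil.
    by exfalso; case: x => x; rewrite Unil finset.in_set0.
  by rewrite edge_num_edgeless// abs_density_edgeless// density_edgeless// expr0.
have memss D : D \in s -> D \in C :: s by move=> Ds; rewrite inE Ds orbT.
have [IHe IHa IHd] := IHs us (fun D Ds => comps D (memss D Ds))
  (fun D Ds => isos D (memss D Ds)).
have CC := mem_head C s; have compC := comps _ CC.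
have [f femb fcov] := graph_iso_cover (isos _ CC).
have CU : C \subset U (C :: s) by rewrite /U big_cons finset.subsetUl.
have sU : U s \subset U (C :: s) by rewrite /U big_cons finset.subsetUr.
have inU D z : D \in s -> z \in D -> z \in U s.
  by move=> Ds zD; rewrite /U (big_rem D)//= inE zD.
have UinP z : z \in U s -> exists2 D, D \in s & z \in D.
  rewrite /U; elim: (s) => [|D s' IH]; first by rewrite big_nil inE.
  rewrite big_cons inE => /orP[zD|/IH[D' D's zD']].
    by exists D => //; rewrite mem_head.
  by exists D' => //; rewrite inE D's orbT.
have cov : disjoint_cover (incl CU) (incl sU).
  apply: disjoint_cover_incl.
  - move=> z zC; apply/negP => /UinP[D Ds zD].
    have CD : C != D by apply: contraNneq Cs => ->.
    have := component_disjoint compC (comps _ (memss _ Ds)) CD zC.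
    by rewrite zD.
  - by rewrite /U big_cons.
  - by move=> x y; exact: component_closed.
  - move=> x y xy; apply/idP/idP => /UinP[D Ds zD]; apply: (inU _ _ Ds).
      by rewrite -(component_closed (comps _ (memss _ Ds)) xy).
    by rewrite (component_closed (comps _ (memss _ Ds)) xy).
have embC := embedding_incl CU; have embs := embedding_incl sU.
have abC : abs_density nu (induced C) W = abs_density nu F W.
  by rewrite (abs_density_cover femb fcov).
have absU : abs_density nu (induced (U (C :: s))) W =
    (abs_density nu F W ^+ (size s).+1)%E.
  by rewrite (abs_density_split nu embC embs cov Wsm) abC IHa expeS.
split.
- by rewrite (edge_num_split embC embs cov) IHe (edge_num_cover femb fcov) mulSn.
- exact: absU.
move=> finF.
(* A finite absolute density of [F] has finite powers, which supplies the three hypotheses of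
   [density_split]. *)
have absF : abs_density nu F W \is a fin_num.
  rewrite ge0_fin_numE; first exact/(density_finiteE _ _ Wsm.1).
  by apply: integral_ge0.
have fin G n : abs_density nu G W = (abs_density nu F W ^+ n)%E ->
    density_finite nu G W.
  move=> e; apply/(density_finiteE _ _ Wsm.1); rewrite e.
  by rewrite ltey_eq fin_numX.
have finC : density_finite nu (induced C) W by apply: (fin _ 1%N); exact: abC.
rewrite (density_split embC embs cov Wsm) ?(IHd finF).
- by rewrite -(density_cover femb fcov finC) exprS.
- exact: fin absU.
- exact: finC.
- exact: fin IHa.
Qed.

End copies.
End component_powers.

(** * Transfer between a graph and one of its components *)

Section transfer.
Context (R : realType) (d : measure_display) (T : measurableType d).
Variable nu : probability T R.
Implicit Types (S : set (T * T -> R)) (N : (T * T -> R) -> R).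

Lemma eq_is_seminorm S N1 N2 : (forall W, S W -> N1 W = N2 W) ->
  is_seminorm S N1 -> is_seminorm S N2.
Proof.
move=> NE [[S0 Slin] Nge0 Nhom Ntri]; split => //.
- by move=> W SW; rewrite -NE// Nge0.
- move=> a W SW; rewrite -!NE ?Nhom//.
  (* A multiple lies in [S] as a linear combination with the zero function. *)
  suff -> : a \*o W = (a \*o W) \+ cst 0 by exact: Slin.
  by apply/funext => z /=; rewrite addr0.
- move=> V W SV SW; rewrite -!NE ?Ntri//.
  suff -> : V \+ W = (1 \*o V) \+ W by exact: Slin.
  by apply/funext => z /=; rewrite mul1r.
Qed.

Lemma eq_is_norm S N1 N2 : (forall W, S W -> N1 W = N2 W) ->
  is_norm nu S N1 -> is_norm nu S N2.
Proof.
move=> NE [sN N0]; split; first exact: eq_is_seminorm sN.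
by move=> W SW; rewrite -NE//; exact: N0.
Qed.

Lemma sym_measurable_abs (W : T * T -> R) :
  sym_measurable W -> sym_measurable (abs_fun W).
Proof.
move=> [mW symW]; split; first exact: measurableT_comp.
by move=> x y; rewrite /abs_fun symW.
Qed.

Lemma powR_root_expr (a : R) (k e : nat) : 0 <= a -> (0 < k)%N ->
  (a ^+ k) `^ (k * e)%:R^-1 = a `^ e%:R^-1.
Proof.
move=> a0 k0; rewrite -powR_mulrn// -powRrM natrM invfM mulrA mulfV ?mul1r//.
by rewrite pnatr_eq0 -lt0n.
Qed.

Variables (H : sgraph) (C : {set H}).
Hypothesis (CH : C \in nonsingleton_components H).
Hypothesis iso : forall D, D \in nonsingleton_components H ->
  graph_iso (induced D) (induced C).

Let k := #|nonsingleton_components H|.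
Let k0 : (0 < k)%N.
Proof. by apply/card_gt0P; exists C. Qed.

(** The nonsingleton components contain every edge, so [H] is their union up to isolated vertices,
    which affect neither edges nor densities. *)
Lemma component_power (W : T * T -> R) : sym_measurable W ->
  [/\ edge_num H = (k * edge_num (induced C))%N,
      density_finite nu H W <-> density_finite nu (induced C) W &
      density_finite nu (induced C) W ->
      density nu H W = density nu (induced C) W ^+ k].
Proof.
move=> Wsm; pose s := enum (nonsingleton_components H).
have ssub D : D \in s -> D \in nonsingleton_components H by rewrite mem_enum.
have scomp D : D \in s -> D \in components H.
  by move=> /ssub; rewrite inE => /andP[].
have siso D : D \in s -> graph_iso (induced D) (induced C).
  by move=> /ssub; exact: iso.
have [] := copies_power nu Wsm (enum_uniq _) scomp siso.
rewrite -cardE -/k; set U := (\bigcup_(D <- s) D)%SET => eU aU dU.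
have cov x y : @adj H x y ->
    (x \in codom (fun z : induced U => val z)) &&
    (y \in codom (fun z : induced U => val z)).
  have inU u v : adj u v -> u \in codom (fun z : induced U => val z).
    move=> /edge_component[D DH uD].
    have uU : u \in U.
      have Ds : D \in s by rewrite mem_enum.
      by rewrite /U (big_rem D)//= inE uD.
    by apply/codomP; exists (exist _ u uU).
  by move=> xy; rewrite (inU _ _ xy) (inU y x)// adj_sym.
have embU := embedding_val U.
have aH : abs_density nu H W = (abs_density nu (induced C) W ^+ k)%E.
  by rewrite (abs_density_cover nu Wsm embU cov).
have a0 : (0 <= abs_density nu (induced C) W)%E by exact: integral_ge0.
have finH : density_finite nu H W <-> density_finite nu (induced C) W.
  rewrite !(density_finiteE _ _ Wsm.1) aH.
  split=> [|fina]; last by rewrite -ge0_fin_numE ?expe_ge0// fin_numX// ge0_fin_numE.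
  (* An infinite value would have an infinite power, because [k] is positive. *)
  case: (abs_density _ _ _) a0 => [r _ _|_|//]; first exact: ltry.
  by rewrite -(prednK k0) expeS gt0_mulye// expe_gt0.
split => //; first by rewrite (edge_num_cover embU cov).
move=> finC; rewrite -(dU finC); apply: (density_cover Wsm embU cov).
apply/(density_finiteE _ _ Wsm.1); rewrite aU -aH.
by apply/(density_finiteE _ _ Wsm.1)/finH.
Qed.

Lemma kernels_component : kernels nu H = kernels nu (induced C).
Proof.
apply/seteqP; split=> W [Wsm finW]; split => //;
  by have [_ finE _] := component_power Wsm; apply/finE.
Qed.

Lemma abs_kernels_component : abs_kernels nu H = abs_kernels nu (induced C).
Proof.
apply/seteqP; split=> W [Wsm finW]; split => //;
  by have [_ finE _] := component_power (sym_measurable_abs Wsm); apply/finE.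
Qed.

Lemma norm_H_component W : kernels nu (induced C) W ->
  norm_H nu H W = norm_H nu (induced C) W.
Proof.
move=> [Wsm finW]; have [eH _ dH] := component_power Wsm.
by rewrite /norm_H eH dH// normrX powR_root_expr.
Qed.

Lemma norm_rH_component W : abs_kernels nu (induced C) W ->
  norm_rH nu H W = norm_rH nu (induced C) W.
Proof.
move=> [Wsm finW]; have [eH _ dH] := component_power (sym_measurable_abs Wsm).
rewrite /norm_rH eH dH// powR_root_expr//.
apply: Rintegral_ge0 => x _; apply: prodr_ge0 => p _; exact: normr_ge0.
Qed.

Lemma seminorming_component : seminorming nu H <-> seminorming nu (induced C).
Proof.
rewrite /seminorming kernels_component; split; apply: eq_is_seminorm => W SW.
  exact: norm_H_component.
by rewrite norm_H_component.
Qed.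

Lemma norming_component : norming nu H <-> norming nu (induced C).
Proof.
rewrite /norming kernels_component; split; apply: eq_is_norm => W SW.
  exact: norm_H_component.
by rewrite norm_H_component.
Qed.

Lemma weakly_norming_component :
  weakly_norming nu H <-> weakly_norming nu (induced C).
Proof.
rewrite /weakly_norming abs_kernels_component; split; apply: eq_is_norm => W SW.
  exact: norm_rH_component.
by rewrite norm_rH_component.
Qed.

End transfer.

(** * Homomorphism densities of step kernels *)

Section step_kernels.
Variable R : realType.
Implicit Types (G H : sgraph) (K : finType).

Definition hom_sum G K (w : K * K -> R) : R :=
  \sum_(f : {ffun G -> K}) \prod_(p in edges G) w (f p.1, f p.2).

(** The density of [G] in the step kernel with values [w] on an equipartition into [#|K|] classes,
    see [density_step]. *)
Definition hom_density G K (w : K * K -> R) : R :=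
  hom_sum G w / #|K|%:R ^+ #|G|.

Lemma hom_density_ge0 G K (w : K * K -> R) : (forall p, 0 <= w p) ->
  0 <= hom_density G w.
Proof.
move=> w0; rewrite divr_ge0 ?exprn_ge0//; apply: sumr_ge0 => f _.
exact: prodr_ge0.
Qed.

Lemma le_hom_density G K (u w : K * K -> R) :
  (forall p, 0 <= u p <= w p) -> hom_density G u <= hom_density G w.
Proof.
move=> uw; rewrite ler_wpM2r ?invr_ge0 ?exprn_ge0//.
by apply: ler_sum => f _; apply: ler_prod => p _.
Qed.

Lemma hom_densityZ G K (c : R) (w : K * K -> R) :
  hom_density G (fun p => c * w p) = c ^+ edge_num G * hom_density G w.
Proof.
rewrite /hom_density mulrA; congr (_ / _).
rewrite /hom_sum big_distrr; apply: eq_bigr => f _ /=.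
by rewrite big_split/= prodr_const.
Qed.

Lemma hom_density1 G K : (0 < #|K|)%N -> hom_density G (fun _ : K * K => 1) = 1.
Proof.
move=> K0; rewrite /hom_density /hom_sum.
rewrite big1_eq.
by rewrite sumr_const card_ffun natrX divff// expf_neq0// pnatr_eq0 -lt0n.
Qed.

Definition tensor_sq K (w : K * K -> R) (p : (K * K) * (K * K)) : R :=
  w (p.1.1, p.2.1) * w (p.1.2, p.2.2).

(** A map into [K * K] is a pair of maps into [K], so the weighted count and the normalisation are
    both squared. *)
Lemma hom_density_tensor_sq G K (w : K * K -> R) :
  hom_density G (tensor_sq w) = hom_density G w ^+ 2.
Proof.
rewrite /hom_density expr_div_n; congr (_ / _); last first.
  by rewrite card_prod natrM exprMn expr2.
rewrite expr2 /hom_sum big_distrlr pair_big/=.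
pose join (q : {ffun G -> K} * {ffun G -> K}) := [ffun v => (q.1 v, q.2 v)].
rewrite (reindex join)/=.
  by apply: eq_bigr => q _; rewrite -big_split; apply: eq_bigr => p _;
    rewrite /tensor_sq !ffunE.
exists (fun f : {ffun G -> K * K} => ([ffun v => (f v).1], [ffun v => (f v).2])).
  by move=> [f g] _; congr (_, _); apply/ffunP => v; rewrite !ffunE.
by move=> f _; apply/ffunP => v; rewrite !ffunE -surjective_pairing.
Qed.

(** The common consequence of the three properties: on nonnegative weights the absolute values
    disappear. *)
Definition hom_triangle H := forall K (u w : K * K -> R), (0 < #|K|)%N ->
  (forall x y, u (x, y) = u (y, x)) -> (forall x y, w (x, y) = w (y, x)) ->
  (forall p, 0 <= u p) -> (forall p, 0 <= w p) ->
  hom_density H (fun p => u p + w p) `^ (edge_num H)%:R^-1 <=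
  hom_density H u `^ (edge_num H)%:R^-1 +
  hom_density H w `^ (edge_num H)%:R^-1.

Lemma powR_invK (a : R) (n : nat) : 0 <= a -> (0 < n)%N ->
  (a `^ n%:R^-1) ^+ n = a.
Proof.
move=> a0 n0; rewrite -powR_mulrn ?powR_ge0// -powRrM mulVf ?powRr1//.
by rewrite pnatr_eq0 -lt0n.
Qed.

(** * Bounds on the densities of the pieces *)

Section rigidity.
Variables (G1 G2 H : sgraph).
Hypothesis H0 : (0 < edge_num H)%N.
Hypothesis homH : forall K (w : K * K -> R), (0 < #|K|)%N ->
  (forall x y, w (x, y) = w (y, x)) ->
  hom_density H w = hom_density G1 w * hom_density G2 w.

Let root K (w : K * K -> R) := hom_density H w `^ (edge_num H)%:R^-1.

Hypothesis triangle : hom_triangle H.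

Let rootX K (w : K * K -> R) : (forall p, 0 <= w p) ->
  root w ^+ edge_num H = hom_density H w.
Proof. by move=> w0; rewrite powR_invK ?hom_density_ge0. Qed.

Let affine_bound K (w : K * K -> R) (c : R) : (0 < #|K|)%N ->
  (forall x y, w (x, y) = w (y, x)) -> (forall p, 0 <= w p) -> 0 <= c ->
  c ^+ edge_num G1 * hom_density G1 w <= (1 + c * root w) ^+ edge_num H.
Proof.
move=> K0 wsym w0 c0.
pose u (p : K * K) := 1 + c * w p.
have usym x y : u (x, y) = u (y, x) by rewrite /u wsym.
have u0 p : 0 <= u p by rewrite addr_ge0// mulr_ge0.
apply: (@le_trans _ _ (hom_density H u)).
  (* The factor of [G1] is bounded below through [1 + c w >= c w], that of [G2] through
     [1 + c w >= 1]. *)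
  rewrite homH// -hom_densityZ -[leLHS]mulr1 -(hom_density1 G2 K0).
  apply: ler_pM; rewrite ?hom_density_ge0//.
  - by move=> p; rewrite mulr_ge0.
  - by apply: le_hom_density => p; rewrite mulr_ge0//= lerDr.
  - by apply: le_hom_density => p; rewrite ler01 lerDl mulr_ge0.
rewrite -rootX// ler_pXn2r ?nnegrE ?powR_ge0// ?addr_ge0 ?mulr_ge0 ?powR_ge0//.
have : root u <= root (fun _ : K * K => 1) + root (fun p => c * w p).
  by apply: triangle => // [x y|p]; [rewrite wsym|rewrite mulr_ge0].
rewrite [root (fun _ => 1)]/root hom_density1// powR1.
suff -> : root (fun p => c * w p) = c * root w by [].
rewrite {1}/root hom_densityZ powRM ?exprn_ge0 ?hom_density_ge0//.
rewrite -powR_mulrn// -powRrM mulfV ?powRr1//.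
by rewrite pnatr_eq0 -lt0n.
Qed.

Let root_tensor K (w : K * K -> R) : (forall p, 0 <= w p) ->
  root (tensor_sq w) = root w ^+ 2.
Proof.
move=> w0; rewrite {1}/root hom_density_tensor_sq.
by rewrite !expr2 powRM ?hom_density_ge0.
Qed.

(* Tensor-power trick: passing from w to its tensor square squares both sides
   but not the constant 2 ^ e(H). *)
Lemma hom_density_le_root K (w : K * K -> R) : (0 < #|K|)%N ->
  (forall x y, w (x, y) = w (y, x)) -> (forall p, 0 <= w p) ->
  hom_density G1 w <= root w ^+ edge_num G1.
Proof.
(* If the root vanishes, the upper bound is 1 for every [c], which excludes a positive density once
   [G1] has an edge. *)
move=> K0 wsym w0; have [h0|hneq0] := eqVneq (root w) 0.
  have bound c : 0 <= c -> c ^+ edge_num G1 * hom_density G1 w <= 1.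
    by move=> /(affine_bound K0 wsym w0); rewrite h0 mulr0 addr0 expr1n.
  (* Without edges the claim reads [t <= 0 ^ 0 = 1], the bound at [c = 1]. *)
  case: (edge_num G1) bound => [|e] bound.
    by have := bound _ ler01; rewrite h0 !expr0 mul1r.
  rewrite h0 expr0n/= leNgt; apply/negP => t0.
  set t := hom_density G1 w in bound t0 *.
  (* For [c = 1 + 1 / t] one has [c ^ (e + 1) t >= c t = t + 1 > 1]. *)
  have c1 : 1 <= 1 + t^-1 by rewrite lerDl invr_ge0 ltW.
  have := bound _ (le_trans ler01 c1); apply/negP; rewrite -ltNge.
  apply: (@lt_le_trans _ _ ((1 + t^-1) * t)).
    rewrite mulrDl mulVf ?gt_eqF// mul1r ltrDr; exact: t0.
  by rewrite ler_pM2r// exprS ler_peMr ?exprn_ege1// (le_trans ler01).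
have h0 : 0 < root w by rewrite lt_neqAle eq_sym hneq0 powR_ge0.
(* The claim is that this quotient is at most 1. With [c] the inverse of the root, [affine_bound]
   gives the crude bound [2 ^ e(H)]. *)
pose q K' (w' : K' * K' -> R) := hom_density G1 w' / root w' ^+ edge_num G1.
have qle K' (w' : K' * K' -> R) : (0 < #|K'|)%N ->
    (forall x y, w' (x, y) = w' (y, x)) -> (forall p, 0 <= w' p) ->
    0 < root w' -> q K' w' <= 2 ^+ edge_num H.
  move=> K'0 w'sym w'0 h'0.
  have := @affine_bound _ w' (root w')^-1 K'0 w'sym w'0.
  rewrite invr_ge0 (ltW h'0) => /(_ isT).
  by rewrite mulVf ?gt_eqF// exprVn mulrC.
have qpow n : exists K' (w' : K' * K' -> R), [/\ (0 < #|K'|)%N,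
    forall x y, w' (x, y) = w' (y, x), forall p, 0 <= w' p, 0 < root w' &
    q K' w' = q K w ^+ (2 ^ n)].
  elim: n => [|n [K' [w' [K'0 w'sym w'0 h'0 qE]]]].
    by exists K, w; split => //; rewrite expr1.
  exists (K' * K')%type, (tensor_sq w'); split.
  - by rewrite card_prod muln_gt0 K'0.
  - by move=> [a b] [a' b']; rewrite /tensor_sq/= w'sym (w'sym b).
  - by move=> p; rewrite mulr_ge0.
  - by rewrite root_tensor// exprn_gt0.
  - rewrite expnSr exprM -qE /q root_tensor// hom_density_tensor_sq.
    by rewrite [RHS]expr_div_n -!exprM [in RHS]mulnC.
suff : q K w <= 1 by rewrite /q ler_pdivrMr ?exprn_gt0// mul1r.
rewrite leNgt; apply/negP => q1.
(* By Bernoulli's inequality the powers of a quotient above 1 pass the constant [2 ^ e(H)]. *)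
have [n nlt] : exists n, 2 ^+ edge_num H < q K w ^+ (2 ^ n).
  have q10 : 0 < q K w - 1 by rewrite subr_gt0.
  pose n := (Num.truncn (2 ^+ edge_num H / (q K w - 1))).+1; exists n.
  have bern i : 1 + i%:R * (q K w - 1) <= q K w ^+ i.
    elim: i => [|i IHi]; first by rewrite mul0r addr0 expr0.
    rewrite exprS; apply: (@le_trans _ _ (q K w * (1 + i%:R * (q K w - 1)))).
      have i0 : 0 <= i%:R * (q K w - 1) * (q K w - 1) by rewrite !mulr_ge0 ?(ltW q10).
      by rewrite -[i.+1%:R]natr1; nra.
    by rewrite ler_wpM2l// ltW// (lt_trans ltr01).
  have : 2 ^+ edge_num H < n%:R * (q K w - 1).
    by rewrite -ltr_pdivrMr//; exact: truncnS_gt.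
  move=> /lt_le_trans; apply.
  apply: le_trans (bern _); rewrite -[leLHS]add0r lerD// ler_wpM2r ?(ltW q10)//.
  by rewrite ler_nat ltnW// ltn_expl.
have [K' [w' [K'0 w'sym w'0 h'0 qE]]] := qpow n.
by have := qle _ _ K'0 w'sym w'0 h'0; rewrite qE leNgt nlt.
Qed.

End rigidity.

Lemma hom_density_component_root (G1 G2 H : sgraph) :
  edge_num H = (edge_num G1 + edge_num G2)%N -> (0 < edge_num G1)%N ->
  (forall K (w : K * K -> R), (0 < #|K|)%N ->
    (forall x y, w (x, y) = w (y, x)) ->
    hom_density H w = hom_density G1 w * hom_density G2 w) ->
  hom_triangle H ->
  forall K (w : K * K -> R), (0 < #|K|)%N ->
    (forall x y, w (x, y) = w (y, x)) -> (forall p, 0 <= w p) ->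
    hom_density G1 w = (hom_density H w `^ (edge_num H)%:R^-1) ^+ edge_num G1.
Proof.
move=> eH e1 homH tri K w K0 wsym w0.
have H0 : (0 < edge_num H)%N by rewrite eH addn_gt0 e1.
have le1 := hom_density_le_root H0 homH tri K0 wsym w0.
have le2 : hom_density G2 w <= (hom_density H w `^ (edge_num H)%:R^-1) ^+ edge_num G2.
  apply: (hom_density_le_root (G2 := G1) H0 _ tri) => //.
  by move=> K' w' K'0 w'sym; rewrite homH// mulrC.
set h := _ `^ _ in le1 le2 *.
have h0 : 0 <= h by exact: powR_ge0.
have t1 := hom_density_ge0 G1 w0; have t2 := hom_density_ge0 G2 w0.
have prodE : hom_density G1 w * hom_density G2 w = h ^+ edge_num G1 * h ^+ edge_num G2.
  by rewrite -exprD -eH -homH// /h powR_invK// hom_density_ge0.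
(* If [h = 0], the right-hand side vanishes because [G1] has an edge. Otherwise a strict inequality
   in the first factor would make the product strictly smaller than [h ^ e(H)], which it equals. *)
apply/eqP; rewrite eq_le le1/=; have [hz|hneq0] := eqVneq h 0.
  by rewrite hz expr0n gtn_eqF.
have hpos : 0 < h by rewrite lt_neqAle eq_sym hneq0.
rewrite leNgt; apply/negP => lt1.
suff : hom_density G1 w * hom_density G2 w < h ^+ edge_num G1 * h ^+ edge_num G2.
  by rewrite prodE ltxx.
apply: (@le_lt_trans _ _ (hom_density G1 w * h ^+ edge_num G2)).
  by rewrite ler_wpM2l.
by rewrite ltr_pM2r// exprn_gt0.
Qed.

End step_kernels.

(** * Step kernels over an equipartition *)

Lemma measurable_finite_valued (d1 d2 : measure_display)
    (T1 : measurableType d1) (T2 : measurableType d2) (K : finType)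
    (F : T1 -> K) (h : K -> T2) :
  (forall a, measurable (F @^-1` [set a])) -> measurable_fun setT (h \o F).
Proof.
move=> mF _ Y _; rewrite setTI.
rewrite (_ : _ @^-1` _ = \bigcup_(a in [set a | Y (h a)]) F @^-1` [set a]).
  by apply: fin_bigcup_measurable => //; exact: finite_finset.
by apply/seteqP; split=> [x Yx|x [a Ya] /= Fx]; [exists (F x)|rewrite /preimage/= Fx].
Qed.

Section density_step.
Context (R : realType) (d : measure_display) (T : measurableType d).
Variables (nu : probability T R) (K : finType) (f : T -> K).
Hypothesis K0 : (0 < #|K|)%N.
Hypothesis fP : forall a, measurable (f @^-1` [set a]) /\
  nu (f @^-1` [set a]) = (#|K|%:R^-1)%:E.

Definition step (w : K * K -> R) (z : T * T) : R := w (f z.1, f z.2).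

Lemma step_sym_measurable (w : K * K -> R) :
  (forall x y, w (x, y) = w (y, x)) -> sym_measurable (step w).
Proof.
move=> wsym; split; last by move=> x y; exact: wsym.
apply: (@measurable_finite_valued _ _ _ _ (K * K)%type (fun z : T * T => (f z.1, f z.2)) w).
move=> [a b].
rewrite (_ : _ @^-1` _ = (f @^-1` [set a]) `*` (f @^-1` [set b])).
  by apply: measurableX; [case: (fP a)|case: (fP b)].
by apply/seteqP; split=> -[x y] /= [fx fy]; [split|rewrite /= fx fy].
Qed.

Section integral.
Variables (G : sgraph) (w : K * K -> R).

Let colouring (x : #|G|.-tuple T) : {ffun G -> K} :=
  [ffun v => f (tnth x (enum_rank v))].

Let weight (g : {ffun G -> K}) : R := \prod_(p in edges G) w (g p.1, g p.2).

Let class_box (g : {ffun G -> K}) : colouring @^-1` [set g] =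
  [set x | forall i, (f @^-1` [set g (enum_val i)]) (tnth x i)].
Proof.
apply/seteqP; split=> x /=.
  by move=> <- i; rewrite ffunE enum_valK.
by move=> xg; apply/ffunP => v; rewrite ffunE xg enum_rankK.
Qed.

Let mclass g : measurable (colouring @^-1` [set g]).
Proof.
rewrite class_box (_ : [set x | _] = \bigcap_(i in [set: 'I_#|G|])
    ((fun x => tnth x i) @^-1` (f @^-1` [set g (enum_val i)]))).
  apply: fin_bigcap_measurable => //= i _.
  rewrite -[X in measurable X]setTI; apply: measurable_tnth => //.
  by case: (fP (g (enum_val i))).
by apply/seteqP; split=> x /= xg i; [move=> _|]; exact: xg.
Qed.

Let prob_class g : prob_power nu #|G| (colouring @^-1` [set g]) =
  (#|K|%:R ^- #|G|)%:E.
Proof.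
have mA i : measurable (f @^-1` [set g (@enum_val _ G i)]).
  by case: (fP (g (enum_val i))).
rewrite class_box; apply: etrans (prob_power_box nu mA) _.
under eq_bigr => i _ do rewrite (fP (g (enum_val i))).2.
by rewrite prodEFin prodr_const card_ord exprVn.
Qed.

(** The classes of the colourings partition the space, so only the colouring induced by [x]
    contributes. *)
Let edge_prod_step (x : #|G|.-tuple T) : (edge_prod (step w) x)%:E =
  (\sum_(g : {ffun G -> K})
     (weight g)%:E * (\1_(colouring @^-1` [set g]) x)%:E)%E.
Proof.
rewrite (bigD1 (colouring x))//= big1 => [|g gx]; last first.
  by rewrite indicE memNset ?mule0// => /= xg; rewrite xg eqxx in gx.
rewrite adde0 indicE mem_set// mule1; congr EFin.
by apply: eq_bigr => p _; rewrite /step !ffunE.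
Qed.

Let integrable_term g : (prob_power nu #|G|).-integrable setT
  (fun x => (weight g)%:E * (\1_(colouring @^-1` [set g]) x)%:E)%E.
Proof.
by apply: integrableZl => //; exact: integrable_indic.
Qed.

Lemma density_finite_step : density_finite nu G (step w).
Proof.
rewrite /density_finite.
rewrite (_ : _ \o _ = fun x => (\sum_(g : {ffun G -> K})
     (weight g)%:E * (\1_(colouring @^-1` [set g]) x)%:E)%E).
  by apply: integrable_sum => // g _; exact: integrable_term.
by apply/funext => x; exact: edge_prod_step.
Qed.

(** The edge product is a simple function, constant on the classes of the colourings, which all have
    probability [#|K| ^ (- #|G|)]. *)
Lemma density_step : density nu G (step w) = hom_density G w.
Proof.
rewrite /density /Rintegral.
under eq_integral do rewrite edge_prod_step.
rewrite integral_sum//.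
under eq_bigr => g _.
  rewrite integralZl//; last first.
    exact: integrable_indic.
  rewrite integral_indic// setIT [X in (_ * X)%E](prob_class g) -EFinM.
  over.
by rewrite sumEFin/= /hom_density /hom_sum mulr_suml.
Qed.

End integral.
End density_step.

Section norm_step.
Context (R : realType) (d : measure_display) (T : measurableType d).
Variables (nu : probability T R) (nu_atomless : atomless nu).
Implicit Types (G H : sgraph) (K : finType).

(** Realising [w] as a step kernel reduces this to the factorisation of integrals. *)
Lemma hom_density_split G1 G2 H (f1 : G1 -> H) (f2 : G2 -> H) :
  embedding f1 -> embedding f2 -> disjoint_cover f1 f2 ->
  forall K (w : K * K -> R), (0 < #|K|)%N ->
    (forall x y, w (x, y) = w (y, x)) ->
    hom_density H w = hom_density G1 w * hom_density G2 w.
Proof.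
move=> e1 e2 cov K w K0 wsym.
have [f fP] := atomless_equipartition nu_atomless K0.
rewrite -!(density_step fP).
by apply: (density_split e1 e2 cov (step_sym_measurable fP wsym)) => //;
  exact: (density_finite_step fP).
Qed.

(** Over a fixed equipartition the step kernel of a sum is the sum of the step kernels. [S] and [N]
    are abstract to serve both the signed and the absolute functional. *)
Lemma seminorm_hom_triangle H S N : @is_seminorm R d T S N ->
  (forall K (f : T -> K) (w : K * K -> R), (0 < #|K|)%N ->
    (forall a, measurable (f @^-1` [set a]) /\
      nu (f @^-1` [set a]) = (#|K|%:R^-1)%:E) ->
    (forall x y, w (x, y) = w (y, x)) -> (forall p, 0 <= w p) ->
    S (step f w) /\ N (step f w) = hom_density H w `^ (edge_num H)%:R^-1) ->
  hom_triangle R H.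
Proof.
move=> [_ _ _ tri] SN K u w K0 usym wsym u0 w0.
have [f fP] := atomless_equipartition nu_atomless K0.
have [Su <-] := SN _ _ _ K0 fP usym u0.
have [Sw <-] := SN _ _ _ K0 fP wsym w0.
have [|p|_ <-] := SN _ _ (fun p => u p + w p) K0 fP.
- by move=> x y; rewrite usym wsym.
- exact: addr_ge0.
- exact: tri.
Qed.

Lemma seminorming_hom_triangle H : seminorming nu H -> hom_triangle R H.
Proof.
move=> sH; apply: seminorm_hom_triangle sH _ => K f w K0 fP wsym w0; split.
  by split; [exact: (step_sym_measurable fP)|exact: (density_finite_step fP)].
by rewrite /norm_H (density_step fP) ger0_norm// hom_density_ge0.
Qed.

Lemma weakly_norming_hom_triangle H : weakly_norming nu H -> hom_triangle R H.
Proof.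
move=> [sH _]; apply: seminorm_hom_triangle sH _ => K f w K0 fP wsym w0.
have absE : abs_fun (step f w) = step f w.
  by apply/funext => z; rewrite /abs_fun ger0_norm// w0.
split; last by rewrite /norm_rH absE (density_step fP).
split; first exact: (step_sym_measurable fP).
by rewrite absE; exact: (density_finite_step fP).
Qed.

End norm_step.

(** * Homomorphism counts *)

Section homomorphisms.
Implicit Types (G : sgraph) (K : finType).

Definition homs G K (r : rel K) : {set {ffun G -> K}} :=
  [set f : {ffun G -> K} | [forall x, forall y, adj x y ==> r (f x) (f y)]]%SET.

Lemma homsP G K (r : rel K) (f : {ffun G -> K}) :
  reflect (forall x y, adj x y -> r (f x) (f y)) (f \in homs G r).
Proof.
rewrite inE; apply: (iffP forallP) => h x; last by apply/forallP => y; apply/implyP/h.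
by move=> y; have /forallP/(_ y)/implyP := h x.
Qed.

Lemma hom_sum_homs (R : realType) G K (r : rel K) : symmetric r ->
  hom_sum G (fun p => (r p.1 p.2)%:R) = #|homs G r|%:R :> R.
Proof.
move=> rsym; rewrite /hom_sum -sum1_card natr_sum [RHS]big_mkcond/=.
apply: eq_bigr => f _; case: ifPn => [/homsP fhom|fNhom].
  by apply: big1 => p; rewrite inE => /andP[/fhom ->].
(* A map that is not a homomorphism breaks an edge, in its listed orientation by symmetry of [r],
   and its product has a zero factor. *)
have [p pE rp] : exists2 p, p \in edges G & ~~ r (f p.1) (f p.2).
  apply/exists_inP; apply: contraR fNhom => /exists_inPn rE.
  apply/homsP => x y xy; have [lt|le] := ltnP (enum_rank x) (enum_rank y).
    by have := rE (x, y); rewrite inE/= xy lt negbK; apply.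
  have := rE (y, x); rewrite inE/= adj_sym xy negbK rsym; apply => /=.
  rewrite ltn_neqAle le andbT; apply/negP => /eqP/val_inj/enum_rank_inj yx.
  by rewrite yx adj_irr in xy.
by rewrite (bigD1 p)//= (negbTE rp) mul0r.
Qed.

Definition no_isolated G := forall x : G, exists y, adj x y.

(** Connectedness, in the form that homomorphisms into disjoint loops use directly. *)
Definition edge_connected G := forall (A : Type) (g : G -> A),
  (forall x y, adj x y -> g x = g y) -> forall x y, g x = g y.

(** On [bool], [andb] is a loop at [true] with [false] isolated, so every vertex that has a
    neighbour goes to [true]. *)
Lemma card_homs_and G : no_isolated G -> #|homs G andb| = 1%N.
Proof.
move=> iso; rewrite -(cards1 ([ffun=> true] : {ffun G -> bool})); congr #|pred_of_set _|.
apply/setP => f; rewrite finset.in_set1; apply/homsP/eqP => [fhom|-> x y _].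
  apply/ffunP => x; rewrite ffunE; have [y xy] := iso x.
  by have /andP[] := fhom _ _ xy.
by rewrite !ffunE.
Qed.

(** On [bool], equality is two disjoint loops, and a connected graph maps to one of them; [x0] makes
    the two constant maps distinct. *)
Lemma card_homs_eq G (x0 : G) : edge_connected G ->
  #|homs G (@eq_op bool)| = 2%N.
Proof.
move=> conn.
have -> : homs G (@eq_op bool) = [set [ffun=> true]; [ffun=> false]]%SET.
  apply/setP => f; rewrite finset.in_set2; apply/homsP/orP => [fhom|fE x y _]; last first.
    by case: fE => /eqP ->; rewrite !ffunE.
  have fc x : f x = f x0 by apply: conn => u v uv; apply/eqP/fhom.
  by case: (f x0) fc => fc; [left|right]; apply/eqP/ffunP => x; rewrite ffunE.
rewrite cards2; case: eqP => // /ffunP/(_ x0).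
by rewrite !ffunE.
Qed.

Section surjective.
Variables (K : finType) (r : rel K).
Implicit Types S : {set K}.

Let rin S : rel K := fun x y => [&& r x y, x \in S & y \in S].

Let homs_onto G S := [set f in homs G r | f @: [set: G] == S]%SET.

(** Restricting [r] to [S] constrains the endpoints of edges; without isolated vertices these are
    all the vertices. *)
Let homs_rin G S : no_isolated G ->
  homs G (rin S) = [set f in homs G r | f @: [set: G] \subset S]%SET.
Proof.
move=> iso; apply/setP => f; rewrite [RHS]inE; apply/homsP/andP.
  move=> fhom; split; first by apply/homsP => x y /fhom/and3P[].
  apply/fintype.subsetP => _ /imsetP[x _ ->]; have [y xy] := iso x.
  by have /and3P[] := fhom _ _ xy.
move=> [/homsP fhom /fintype.subsetP fS] x y xy.
by apply/and3P; split; [exact: fhom|apply/fS/imset_f..]; rewrite finset.in_setT.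
Qed.

Let card_homs_rin G S : no_isolated G ->
  #|homs G (rin S)| = (\sum_(S' in powerset S) #|homs_onto G S'|)%N.
Proof.
move=> iso; rewrite homs_rin// -sum1_card.
rewrite (partition_big (fun f : {ffun G -> K} => f @: [set: G])%SET
  (mem (powerset S)))/=; last by move=> f; rewrite !inE => /andP[].
apply: eq_bigr => S' S'S; rewrite -sum1_card; apply: eq_bigl => f.
rewrite !inE in S'S *; case: eqP => [->|]; rewrite ?andbF// ?andbT.
by rewrite S'S andbT.
Qed.

(* Inclusion-exclusion over the image of a homomorphism. *)
Lemma card_homs_surjective G1 G2 : no_isolated G1 -> no_isolated G2 ->
  (forall S, #|homs G1 (rin S)| = #|homs G2 (rin S)|) ->
  forall S, #|homs_onto G1 S| = #|homs_onto G2 S|.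
Proof.
move=> iso1 iso2 eqN S; have [n] := ubnP #|S|.
elim: n S => // n IHn S; rewrite ltnS => Sn.
have SS : S \in powerset S by rewrite powersetE.
have := eqN S; rewrite !card_homs_rin//.
rewrite (big_setD1 S)//= [in RHS](big_setD1 S)//=.
(* The terms of the proper subsets agree by induction and cancel, leaving the term of [S]. *)
rewrite [X in (_ + X = _)%N](eq_bigr (fun S' => #|homs_onto G2 S'|)).
  exact: addIn.
move=> S'; rewrite !inE => /andP[S'neq S'S]; apply: IHn.
apply: leq_trans Sn; apply: proper_card.
by rewrite finset.properEneq S'neq.
Qed.

End surjective.

Lemma card_adj G : #|[set p : G * G | adj p.1 p.2]%SET| = (edge_num G).*2.
Proof.
pose swap (p : G * G) := (p.2, p.1).
have swapK : involutive swap by case.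
rewrite -(cardsID (edges G)) -addnn; congr (_ + _)%N.
  apply: eq_card => p; rewrite !inE.
  by case: (adj p.1 p.2) => //=; rewrite andbF.
rewrite /edge_num -[RHS](card_imset _ (inv_inj swapK)); apply: eq_card => -[x y].
rewrite !inE/=; apply/andP/imsetP => [[lt xy]|[[a b]]].
  exists (y, x) => //; rewrite inE/= adj_sym xy/=.
  move: lt; rewrite xy/= -leqNgt leq_eqVlt => /predU1P[|//].
  by move=> /val_inj/enum_rank_inj yx; rewrite yx adj_irr in xy.
rewrite inE/= => /andP[ab lt] [-> ->]; split; last by rewrite adj_sym.
by rewrite negb_and -leqNgt (ltnW lt) orbT.
Qed.

(** Equal vertex numbers make [f] bijective. It then acts injectively on ordered adjacent pairs, and
    equal edge numbers make this action onto, so [f] also reflects adjacency. *)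
Lemma surjective_hom_iso G1 G2 (f : G2 -> G1) :
  (forall x y, adj x y -> adj (f x) (f y)) ->
  (forall y, exists x, y = f x) -> #|G1| = #|G2| -> edge_num G1 = edge_num G2 ->
  graph_iso G2 G1.
Proof.
move=> fhom fsurj eqV eqE.
have inj_f : injective f.
  apply/injectiveP; rewrite /injectiveb /dinjectiveb.
  apply/card_uniqP; rewrite size_map -cardE -eqV; apply: eq_card => y.
  by rewrite [RHS]inE; apply/mapP; have [x ->] := fsurj y; exists x; rewrite // mem_enum.
exists f; first by apply: inj_card_bij => //; rewrite eqV.
move=> x y; apply/idP/idP => [|/fhom//].
pose ff (p : G2 * G2) := (f p.1, f p.2).
have inj_ff : injective ff by move=> [a b] [a' b'] [/inj_f -> /inj_f ->].
have ffE : ff @: [set p | adj p.1 p.2]%SET = [set p | adj p.1 p.2]%SET.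
  apply/eqP; rewrite eqEcard card_imset// !card_adj eqE leqnn andbT.
  by apply/fintype.subsetP => _ /imsetP[[a b] ab ->]; rewrite !inE/= in ab *; exact: fhom.
move=> fxy; have : (f x, f y) \in ff @: [set p | adj p.1 p.2]%SET.
  by rewrite ffE inE.
by move=> /imsetP[[a b]]; rewrite inE/= => ab [/inj_f -> /inj_f ->].
Qed.

End homomorphisms.

Lemma edge_num_gt0 (G : sgraph) (x : G) : no_isolated G -> (0 < edge_num G)%N.
Proof.
move=> iso; rewrite -double_gt0 -card_adj; apply/card_gt0P.
by have [y xy] := iso x; exists (x, y); rewrite inE.
Qed.

Section hom_density_determines.
Variables (R : realType) (G1 G2 : sgraph) (x1 : G1) (x2 : G2).
Hypotheses (iso1 : no_isolated G1) (iso2 : no_isolated G2).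
Hypotheses (conn1 : edge_connected G1) (conn2 : edge_connected G2).
Hypothesis homE : forall (K : finType) (w : K * K -> R), (0 < #|K|)%N ->
  (forall x y, w (x, y) = w (y, x)) -> (forall p, 0 <= w p) ->
  hom_density G1 w ^+ edge_num G2 = hom_density G2 w ^+ edge_num G1.

Let homs_density (K : finType) (r : rel K) : (0 < #|K|)%N -> symmetric r ->
  (#|homs G1 r|%:R / #|K|%:R ^+ #|G1|) ^+ edge_num G2 =
  (#|homs G2 r|%:R / #|K|%:R ^+ #|G2|) ^+ edge_num G1 :> R.
Proof.
move=> K0 rsym; rewrite -!hom_sum_homs//.
by apply: homE => // x y /=; rewrite rsym.
Qed.

Let bool0 : (0 < #|{: bool}|)%N. Proof. by rewrite card_bool. Qed.

(* Homomorphisms into one looped vertex plus an isolated one determine v / e;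
   those into two disjoint loops then determine e, by connectedness. *)
Let vertex_edge : (2 ^+ #|G1|)^-1 ^+ edge_num G2 = (2 ^+ #|G2|)^-1 ^+ edge_num G1 :> R.
Proof.
have := homs_density bool0 andbC.
by rewrite !card_homs_and// card_bool !mul1r.
Qed.

Lemma edge_num_determined : edge_num G1 = edge_num G2.
Proof.
have := homs_density bool0 (@eq_sym bool).
rewrite (card_homs_eq x1 conn1) (card_homs_eq x2 conn2) card_bool !exprMn.
(* The normalising factors are equal by [vertex_edge]; cancelling them leaves
   [2 ^ e(G2) = 2 ^ e(G1)]. *)
rewrite vertex_edge => /mulIf/eqP.
rewrite expf_neq0 ?invr_eq0 ?expf_neq0 ?pnatr_eq0// => /(_ isT).
by rewrite -!natrX eqr_nat eqn_exp2l// => /eqP.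
Qed.

Lemma card_vertex_determined : #|G1| = #|G2|.
Proof.
have e2 : (0 < edge_num G2)%N := edge_num_gt0 x2 iso2.
have /eqP := vertex_edge; rewrite edge_num_determined eqrXn2 ?invr_ge0 ?exprn_ge0//.
by rewrite (inj_eq invr_inj) -!natrX eqr_nat eqn_exp2l// => /eqP.
Qed.

Let homs_determined (K : finType) (r : rel K) : (0 < #|K|)%N -> symmetric r ->
  #|homs G1 r| = #|homs G2 r|.
Proof.
move=> K0 rsym; have /eqP := homs_density K0 rsym.
rewrite edge_num_determined card_vertex_determined.
rewrite eqrXn2 ?(edge_num_gt0 x2)// ?divr_ge0 ?exprn_ge0//.
rewrite (inj_eq (mulIf _)) ?eqr_nat => [/eqP//|].
by rewrite invr_eq0 expf_neq0// pnatr_eq0 -lt0n.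
Qed.

Lemma hom_density_determines : graph_iso G2 G1.
Proof.
have V0 : (0 < #|G1|)%N by apply/card_gt0P; exists x1.
(* The target is [G1] itself; the counts agree for the restriction of its adjacency to every vertex
   set [S]. *)
have := card_homs_surjective iso1 iso2 (r := @adj G1) (fun S =>
  homs_determined V0 (r := fun x y => [&& adj x y, x \in S & y \in S]) _).
move=> /(_ _ [set: G1]%SET) card_onto.
have {card_onto} : (0 < #|[set f in homs G2 (@adj G1) | f @: [set: G2] == [set: G1]]%SET|)%N.
  rewrite -card_onto => [|S x y]; last by rewrite adj_sym [(x \in S) && _]andbC.
  (* The identity of [G1] is a surjective homomorphism. *)
  apply/card_gt0P; exists [ffun x => x]; rewrite inE; apply/andP; split.
    by apply/homsP => x y; rewrite !ffunE.
  apply/eqP/setP => x; rewrite finset.in_setT; apply/imsetP.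
  by exists x; rewrite ?ffunE.
move=> /card_gt0P[f]; rewrite inE => /andP[/homsP fhom /eqP fonto].
apply: (surjective_hom_iso fhom) => [y||].
- have : y \in f @: [set: G2]%SET by rewrite fonto finset.in_setT.
  by move=> /imsetP[x _ ->]; exists x.
- exact: card_vertex_determined.
- exact: edge_num_determined.
Qed.

End hom_density_determines.

(** * Components of a graph with the triangle inequality *)

Lemma no_isolated_component (H : sgraph) (C : {set H}) :
  C \in nonsingleton_components H -> no_isolated (induced C).
Proof.
move=> CH x; have [y yC xy] := component_neighbour CH (valP x).
by exists (exist _ y yC).
Qed.

Lemma hom_triangle_components_iso (R : realType) (d : measure_display)
    (T : measurableType d) (nu : probability T R) (H : sgraph) :
  atomless nu -> hom_triangle R H ->
  forall C D, C \in nonsingleton_components H ->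
    D \in nonsingleton_components H -> graph_iso (induced C) (induced D).
Proof.
move=> nu_atomless tri.
have comp C : C \in nonsingleton_components H -> C \in components H.
  by rewrite inE => /andP[].
have pt C : C \in nonsingleton_components H -> exists x : induced C, True.
  rewrite inE => /andP[_ /ltnW/card_gt0P[x xC]].
  by exists (exist _ x xC).
have root C : C \in nonsingleton_components H ->
    forall (K : finType) (w : K * K -> R), (0 < #|K|)%N ->
    (forall x y, w (x, y) = w (y, x)) -> (forall p, 0 <= w p) ->
    hom_density (induced C) w =
    (hom_density H w `^ (edge_num H)%:R^-1) ^+ edge_num (induced C).
  move=> CH; have [x _] := pt _ CH.
  have cov := disjoint_cover_setC (comp _ CH).
  have e1 := embedding_val C; have e2 := embedding_val (~: C)%SET.
  apply: (hom_density_component_root (edge_num_split e1 e2 cov)) => //.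
    exact: edge_num_gt0 x (no_isolated_component CH).
  exact: (hom_density_split nu_atomless e1 e2 cov).
move=> C D CH DH; have [x _] := pt _ CH; have [y _] := pt _ DH.
(* The isomorphism obtained goes from the second graph to the first, so [D] is taken first. *)
apply: (@hom_density_determines R _ _ y x).
- exact: no_isolated_component.
- exact: no_isolated_component.
- by move=> A g; exact: component_const (comp _ DH).
- by move=> A g; exact: component_const (comp _ CH).
(* Both sides are the root of the density of [H] raised to the power [e(C) e(D)]. *)
by move=> K w K0 wsym w0; rewrite !root// -!exprM mulnC.
Qed.

Theorem theorem1p2 (R : realType) (d : measure_display) (T : measurableType d)
    (nu : probability T R) (T_borel : standard_borel R T)
    (nu_atomless : atomless nu) (H : sgraph) (H_edge : (0 < edge_num H)%N) :
  [/\ weakly_norming nu H <-> components_iso_and (weakly_norming nu) H,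
      seminorming nu H <-> components_iso_and (seminorming nu) H &
      norming nu H <-> components_iso_and (norming nu) H].
Proof.
(* A representative from which the property passes back to [H]. *)
have [C0 C0H] : exists C, C \in nonsingleton_components H.
  have [[x y]] := card_gt0P H_edge; rewrite inE/= => /andP[xy _].
  by have [C CH _] := edge_component xy; exists C.
(* Each of the three properties enters only through the triangle inequality on weights and its
   transfer between [H] and a component. *)
have transfer (P : sgraph -> Prop) : (P H -> hom_triangle R H) ->
    (forall C, C \in nonsingleton_components H ->
      (forall D, D \in nonsingleton_components H ->
        graph_iso (induced D) (induced C)) -> P H <-> P (induced C)) ->
    P H <-> components_iso_and P H.
  move=> Ptri Pcomp; split=> [PH|[iso PC]].
    have iso := hom_triangle_components_iso nu_atomless (Ptri PH).
    split=> // C CH; apply/(Pcomp C CH) => // D DH; exact: iso.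
  by apply/(Pcomp C0 C0H) => [D DH|]; [exact: iso|exact: PC].
split; apply: transfer => [PH|C CH iso].
- exact: weakly_norming_hom_triangle PH.
- exact: weakly_norming_component.
- exact: seminorming_hom_triangle PH.
- exact: seminorming_component.
- exact: seminorming_hom_triangle PH.1.
- exact: norming_component.
Qed.
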